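(* Let $n\geq 2$ be an integer. For every real number $R \geq \sqrt{2^{n-1}+2^{n-2}-2}$ there exists a symplectic embedding of the cylinder ${\rm B}^2(1)\times\mathbb{R}^{2(n-1)}$ into the product ${\rm B}^{2(n-1)}(R)\times\mathbb{R}^2$.
   Context: $\mathbb{R}^{2n}$ has coordinates $(x_1,y_1,\ldots,x_n,y_n)$ and carries the standard symplectic form $\omega_0=\sum_{i=1}^n {\rm d}x_i\wedge {\rm d}y_i$. For $R>0$, ${\rm B}^{2m}(R)=\{(x_1,y_1,\ldots,x_m,y_m)\in\mathbb{R}^{2m} : \sum_{i=1}^m (x_i^2+y_i^2)<R^2\}$ is the open ball of radius $R$. Products such as ${\rm B}^{2}(1)\times\mathbb{R}^{2(n-1)}$ and ${\rm B}^{2(n-1)}(R)\times\mathbb{R}^2$ are regarded as open subsets of $\mathbb{R}^{2n}$, the factors occupying consecutive pairs $(x_i,y_i)$. For open subsets $U,V\subset\mathbb{R}^{2n}$, a symplectic embedding $f\colon U\to V$ is a $C^\infty$-smooth embedding with $f^*\omega_0=\omega_0$. *)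

(* Defs.v *)
From HB Require Import structures.
From mathcomp Require Import all_boot all_order all_algebra.
From mathcomp Require Import all_classical all_reals all_analysis.

Set Implicit Arguments.
Unset Strict Implicit.
Unset Printing Implicit Defensive.

Import Order.TTheory GRing.Theory Num.Theory.
Import numFieldNormedType.Exports.

Local Open Scope classical_set_scope.
Local Open Scope ring_scope.

(* R^(2n) is 'rV[R]_(2 * n), with coordinates in the order
   (x_1, y_1, ..., x_n, y_n); the pairs are indexed from 0 here, so the pair
   number i : 'I_n sits at positions 2 * i and 2 * i + 1. *)

Fact xpos_subproof (n : nat) (i : 'I_n) : (2 * i < 2 * n)%N.
Proof. by rewrite ltn_mul2l /=. Qed.

Fact ypos_subproof (n : nat) (i : 'I_n) : ((2 * i).+1 < 2 * n)%N.
Proof. by have := ltn_ord i; rewrite -(leq_pmul2l (ltn0Sn 1)) mulnS. Qed.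

Definition xcoord (R : realType) (n : nat) (z : 'rV[R]_(2 * n)) (i : 'I_n) : R :=
  z ord0 (Ordinal (xpos_subproof i)).

Definition ycoord (R : realType) (n : nat) (z : 'rV[R]_(2 * n)) (i : 'I_n) : R :=
  z ord0 (Ordinal (ypos_subproof i)).

Definition omega0 (R : realType) (n : nat) (u v : 'rV[R]_(2 * n)) : R :=
  \sum_(i < n) (xcoord u i * ycoord v i - ycoord u i * xcoord v i).

(* For m <= n, the open subset B^(2m)(r) x R^(2(n - m)) of R^(2n), the ball
   occupying the first m pairs of coordinates. *)
Definition ball_times_space (R : realType) (n m : nat) (r : R) :
    set 'rV[R]_(2 * n) :=
  [set z | \sum_(i < n | (i < m)%N) (xcoord z i ^+ 2 + ycoord z i ^+ 2)
           < r ^+ 2].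
Arguments ball_times_space {R} n m r _.

(* In the definitions below U is meant to be an open set, so that
   continuity and differentiability at the points of U depend only on the
   restriction of f to U. In finite dimension, requiring x |-> 'd f x v to be
   C^k for every vector v amounts to requiring that the differential be C^k. *)
Fixpoint Ck_on (R : realType) (V W : normedModType R) (k : nat) (U : set V)
    (f : V -> W) : Prop :=
  if k is k'.+1 then
    (forall x, U x -> differentiable f x) /\
    (forall v, Ck_on k' U (fun x => 'd f x v))
  else forall x, U x -> {for x, continuous f}.

Definition smooth_on (R : realType) (V W : normedModType R) (U : set V)
    (f : V -> W) : Prop :=
  forall k, Ck_on k U f.

(* A smooth immersion that is a homeomorphism onto its image, g being the
   inverse homeomorphism; injectivity of f on U is implied by g. *)
Definition smooth_embedding (R : realType) (V W : normedModType R) (U : set V)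
    (f : V -> W) : Prop :=
  [/\ smooth_on U f,
      forall x, U x -> injective ('d f x) &
      exists g : W -> V,
        {within f @` U, continuous g} /\ forall x, U x -> g (f x) = x].

Definition symplectic_embedding (R : realType) (n : nat)
    (U V : set 'rV[R]_(2 * n)) (f : 'rV[R]_(2 * n) -> 'rV[R]_(2 * n)) : Prop :=
  [/\ smooth_embedding U f,
      f @` U `<=` V &
      forall x, U x -> forall u v,
        omega0 ('d f x u) ('d f x v) = omega0 u v].

(* Main.v *)
(* One step trades an unbounded pair of coordinates for a bounded one: a disc of
   area pi * A times R^4 embeds into D x D' x R^2, with D and D' of area slightly
   more than 2 * pi * A.  Flatten the disc to a rectangle (r, y) of sides 1 and
   pi * A, squeeze both planes to strips (phi, p) and (q, p2) with p and p2
   bounded, and shear by the function q * phi, so that the last pair (q, p2 + phi)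
   records the number of turns of phi.  The cotangent lift of polar coordinates
   sends (r, phi) to a thin-holed disc of radius about 1, with fibre coordinates
   read modulo the square lattice of side slightly above pi * A.  Since y varies by
   less than pi * A and p is tiny, nothing is identified, because the lift acts on
   fibres by rotations.  A disc times a 2-torus is a toric domain in R^4, contained
   in D x D' and, the sum of the coordinates on the disc being at most sqrt 2, in a
   ball of squared radius about (2 + sqrt 2) * A.
   Iterating n - 2 times on the first pair gives discs of squared radii 2^(n-2),
   2^(n-2), ..., 4, 2 up to small errors, whose sum is the constant of the theorem;
   the better estimate of the last step absorbs the errors.  The inverse of an
   injective local diffeomorphism being continuous, the map is an embedding. *)
From HB Require Import structures.
Require Import Defs.
From mathcomp Require Import all_boot all_order all_algebra.
From mathcomp Require Import all_classical all_reals all_analysis.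
From mathcomp Require Import ring lra zify.

Set Implicit Arguments.
Unset Strict Implicit.
Unset Printing Implicit Defensive.

Import Order.TTheory GRing.Theory Num.Theory.
Import numFieldNormedType.Exports.

Local Open Scope classical_set_scope.
Local Open Scope ring_scope.

(** * Smooth functions *)

Section differential_near.
Context {R : realType} {V W : normedModType R}.
Implicit Types f g : V -> W.

Lemma near_eq_is_diff f g (x : V) : {near x, f =1 g} -> differentiable f x ->
  is_diff x g ('d f x).
Proof.
move=> fg df.
have fgx : f x = g x by exact: nbhs_singleton fg.
have gE : g \o shift x = cst (g x) + 'd f x +o_ 0 id.
  apply/eqaddoP => e e0.
  have /eqaddoP/(_ _ e0) := diff_locally df.
  have fg0 : \forall h \near 0, f (h + x) = g (h + x).
    by move: fg; rewrite (near_shift 0 x) /= subr0.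
  move=> H; apply: filterS2 fg0 H => h fgh fh.
  have {}fh : `|f (h + x) - (f x + 'd f x h)| <= e * `|h| := fh.
  by rewrite fgh fgx in fh.
have dg : 'd g x = 'd f x :> (V -> W).
  exact: (diff_unique (diff_continuous df) gE).
apply: DiffDef => //; apply/diff_locallyP; rewrite dg; split=> //.
exact: diff_continuous.
Unshelve. all: by end_near. Qed.

End differential_near.

Section Ck.
Context {R : realType} {V : normedModType R}.
Implicit Types (U : set V) (W : normedModType R).

(** Differentials are local, so on an open set any formula valid there can stand in for ['d f] in
    the recursion that defines [Ck_on]. All the closure rules below rest on this. *)
Lemma Ck_on_ext W k U (f g : V -> W) : open U -> (forall x, U x -> f x = g x) ->
  Ck_on k U f -> Ck_on k U g.
Proof.
move=> oU; elim: k f g => [|k IH] f g fg /=.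
  move=> cf x Ux; have nfg : {near x, f =1 g}.
    by apply: filterS (open_nbhs_nbhs (conj oU Ux)); exact: fg.
  rewrite /prop_for /continuous_at -fg //; apply: cvg_trans (cf x Ux).
  by apply: near_eq_cvg; near=> y; near: y; exact: nfg.
move=> [df ddf].
have H x : U x -> is_diff x g ('d f x).
  move=> Ux; apply: near_eq_is_diff; last exact: df.
  by apply: filterS (open_nbhs_nbhs (conj oU Ux)); exact: fg.
split=> [x Ux|v]; first by have [] := H x Ux.
by apply: IH (ddf v) => x Ux; have [_ ->] := H x Ux.
Unshelve. all: by end_near. Qed.

Lemma Ck_onW W k U (f : V -> W) : Ck_on k.+1 U f -> Ck_on k U f.
Proof.
elim: k f => [|k IH] f [df ddf] /=.
  by move=> x Ux; exact/differentiable_continuous/df.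
by split=> // v; apply: IH.
Qed.

Lemma Ck_on_cst W k U (c : W) : Ck_on k U (cst c).
Proof.
elim: k c => [|k IH] c /=; first by move=> x _; exact: cst_continuous.
split=> [x _|v]; first exact: differentiable_cst.
rewrite (_ : (fun x => _) = cst 0); first exact: IH.
by apply/funext => x; rewrite diff_cst.
Qed.

Lemma Ck_on_linear W k U (f : {linear V -> W}) : continuous f -> Ck_on k U f.
Proof.
move=> cf; case: k => [|k] /=; first by move=> x _; exact: cf.
split=> [x _|v]; first exact: linear_differentiable.
rewrite (_ : (fun x => _) = cst (f v)); first exact: Ck_on_cst.
by apply/funext => x; rewrite diff_lin.
Qed.

Lemma Ck_onD W k U (f g : V -> W) : open U ->
  Ck_on k U f -> Ck_on k U g -> Ck_on k U (f \+ g).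
Proof.
move=> oU; elim: k f g => [|k IH] f g /=.
  by move=> cf cg x Ux; apply: continuousD; [exact: cf|exact: cg].
move=> [df ddf] [dg ddg]; split=> [x Ux|v].
  by apply: differentiableD; [exact: df|exact: dg].
apply: Ck_on_ext (IH _ _ (ddf v) (ddg v)) => // x Ux /=.
by rewrite [in RHS](@diffD _ _ _ f g) //; [exact: df|exact: dg].
Qed.

Lemma Ck_onZl W k U (f : V -> R) (w : W) : open U ->
  Ck_on k U f -> Ck_on k U (fun x => f x *: w).
Proof.
move=> oU; elim: k f => [|k IH] f /=.
  by move=> cf x Ux; apply: continuousZr_tmp; exact: cf.
move=> [df ddf]; split=> [x Ux|v]; first by apply: differentiableZl; exact: df.
apply: Ck_on_ext (IH _ (ddf v)) => // x Ux /=.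
by rewrite [in RHS]diffZl //; exact: df.
Qed.

Lemma Ck_onM k U (f g : V -> R) : open U ->
  Ck_on k U f -> Ck_on k U g -> Ck_on k U (f \* g).
Proof.
move=> oU; elim: k f g => [|k IH] f g.
  by move=> cf cg x Ux; apply: continuousM; [exact: cf|exact: cg].
move=> cf cg; have [df ddf] := cf; have [dg ddg] := cg; split=> [x Ux|v].
  by apply: differentiableM; [exact: df|exact: dg].
apply: (Ck_on_ext (f := (f \* (fun x => 'd g x v)) \+
  (g \* (fun x => 'd f x v)))) => //.
  move=> x Ux /=.
  by rewrite [in RHS](@diffM _ _ f g) //; [exact: df|exact: dg].
apply: Ck_onD => //; [exact: IH (Ck_onW cf) (ddg v)|].
exact: IH (Ck_onW cg) (ddf v).
Qed.

Lemma diff_comp1 (F : R -> R) (dF : R) (f : V -> R) x :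
  is_derive (f x) 1 F dF -> differentiable f x ->
  is_diff x (F \o f) (fun v => dF * 'd f x v).
Proof.
move=> [dFx dFE] df.
have dF' : differentiable F (f x) by exact/derivable1_diffP.
apply: DiffDef; first exact: differentiable_comp.
rewrite diff_comp //; apply/funext => v /=.
by rewrite diff1E // derive1E dFE mulrC.
Qed.

(** By the chain rule the differential of [F \o f] is [dF \o f] times that of [f], so one order of
    smoothness is gained from [dF \o f]. This drives the inductions for the inverse, the root and
    the trigonometric functions, whose derivatives are built from the functions themselves. *)
Lemma Ck_on_comp1 k U (F dF : R -> R) (f : V -> R) : open U ->
  (forall x, U x -> is_derive (f x) 1 F (dF (f x))) ->
  Ck_on k.+1 U f -> Ck_on k U (dF \o f) -> Ck_on k.+1 U (F \o f).
Proof.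
move=> oU FF [df ddf] cdF.
have H x (Ux : U x) := @diff_comp1 F _ f x (FF x Ux) (df x Ux).
split=> [x Ux|v]; first by have [] := H x Ux.
apply: (Ck_on_ext (f := (dF \o f) \* (fun x => 'd f x v))) => //.
  by move=> x Ux /=; have [_ ->] := H x Ux.
exact: Ck_onM oU cdF (ddf v).
Qed.

Lemma C0_on_comp1 U (F dF : R -> R) (f : V -> R) :
  (forall x, U x -> is_derive (f x) 1 F (dF (f x))) ->
  Ck_on 0 U f -> Ck_on 0 U (F \o f).
Proof.
move=> FF cf x Ux; apply: continuous_comp; first exact: cf.
have [dFx _] := FF x Ux.
exact/differentiable_continuous/derivable1_diffP.
Qed.

End Ck.

Section smooth.
Context {R : realType} {V : normedModType R}.
Implicit Types (U : set V) (f g : V -> R).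

Lemma smooth_on_cst (W : normedModType R) U (c : W) : smooth_on U (cst c : V -> W).
Proof. by move=> k; exact: Ck_on_cst. Qed.

Lemma smooth_onD (W : normedModType R) U (f g : V -> W) : open U ->
  smooth_on U f -> smooth_on U g -> smooth_on U (fun x => f x + g x).
Proof. by move=> oU sf sg k; exact: Ck_onD. Qed.

Lemma smooth_onM U f g : open U ->
  smooth_on U f -> smooth_on U g -> smooth_on U (fun x => f x * g x).
Proof. by move=> oU sf sg k; exact: Ck_onM. Qed.

Lemma smooth_onN U f : open U -> smooth_on U f -> smooth_on U (fun x => - f x).
Proof.
move=> oU sf; rewrite (_ : (fun x => _) = (fun x => -1 * f x)).
  by apply: smooth_onM => //; exact: smooth_on_cst.
by apply/funext => x /=; rewrite mulN1r.
Qed.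

Lemma smooth_onB U f g : open U ->
  smooth_on U f -> smooth_on U g -> smooth_on U (fun x => f x - g x).
Proof.
by move=> oU sf sg; apply: (smooth_onD (g := fun x => - g x)) => //;
  exact: smooth_onN.
Qed.

Lemma is_derive1_inv (t : R) : t != 0 ->
  is_derive t 1 GRing.inv (- (t^-1 * t^-1)).
Proof.
move=> t0; have d := differentiable_Rinv t0.
apply: DeriveDef; first exact/derivable1_diffP.
by rewrite deriveE // diff_Rinv // expr2 invfM [_ *: _]mulr1.
Qed.

Lemma Ck_onV k U f : open U -> (forall x, U x -> f x != 0) ->
  Ck_on k U f -> Ck_on k U (fun x => (f x)^-1).
Proof.
move=> oU f0.
have D x : U x -> is_derive (f x) 1 GRing.inv (- ((f x)^-1 * (f x)^-1)).
  by move=> Ux; exact/is_derive1_inv/f0.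
elim: k => [|k IH] cf.
  exact: (@C0_on_comp1 _ _ _ GRing.inv (fun t => - (t^-1 * t^-1))).
apply: (@Ck_on_comp1 _ _ _ _ GRing.inv (fun t => - (t^-1 * t^-1))) => //.
have cV := IH (Ck_onW cf).
apply: (Ck_on_ext (f := cst (-1) \* ((fun x => (f x)^-1) \* (fun x => (f x)^-1)))) => //.
  by move=> x _ /=; rewrite mulN1r.
by apply: Ck_onM => //; [exact: Ck_on_cst|exact: Ck_onM].
Qed.

Lemma smooth_onV U f : open U -> (forall x, U x -> f x != 0) ->
  smooth_on U f -> smooth_on U (fun x => (f x)^-1).
Proof. by move=> oU f0 sf k; exact: Ck_onV. Qed.

Lemma smooth_on_sqrt U f : open U -> (forall x, U x -> 0 < f x) ->
  smooth_on U f -> smooth_on U (fun x => Num.sqrt (f x)).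
Proof.
move=> oU f0 sf.
have D x : U x -> is_derive (f x) 1 Num.sqrt (2 * Num.sqrt (f x))^-1.
  by move=> Ux; apply: is_derive1_sqrt; exact: f0.
elim=> [|k IH].
  exact: (@C0_on_comp1 _ _ _ Num.sqrt (fun t => (2 * Num.sqrt t)^-1)).
apply: (@Ck_on_comp1 _ _ _ _ Num.sqrt (fun t => (2 * Num.sqrt t)^-1)) => //.
apply: Ck_onV => //.
  by move=> x Ux; rewrite mulf_neq0 ?pnatr_eq0 // gt_eqF // sqrtr_gt0 f0.
by apply: (@Ck_onM _ _ _ _ (cst 2)) => //; exact: Ck_on_cst.
Qed.

(** Up to sign each of the two functions is the derivative of the other, so a single induction on
    the order must carry both. *)
Lemma smooth_on_trig U f : open U -> smooth_on U f ->
  smooth_on U (fun x => cos (f x)) /\ smooth_on U (fun x => sin (f x)).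
Proof.
move=> oU sf.
suff H k : Ck_on k U (fun x => cos (f x)) /\ Ck_on k U (fun x => sin (f x)).
  by split=> k; have [] := H k.
elim: k => [|k [IHc IHs]].
  split; [apply: (@C0_on_comp1 _ _ _ cos (fun t => - sin t)) => //|
          apply: (@C0_on_comp1 _ _ _ sin cos) => //]; exact: sf.
split; [apply: (@Ck_on_comp1 _ _ _ _ cos (fun t => - sin t)) => //|
        apply: (@Ck_on_comp1 _ _ _ _ sin cos) => //]; try exact: sf.
apply: (Ck_on_ext (f := cst (-1) \* (fun x => sin (f x)))) => //.
  by move=> x _ /=; rewrite mulN1r.
by apply: Ck_onM => //; exact: Ck_on_cst.
Qed.

Lemma smooth_on_asin U f : open U -> (forall x, U x -> -1 < f x < 1) ->
  smooth_on U f -> smooth_on U (fun x => asin (f x)).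
Proof.
move=> oU f1 sf.
have D x : U x -> is_derive (f x) 1 (@asin R) (Num.sqrt (1 - f x ^+ 2))^-1.
  by move=> Ux; apply: is_derive1_asin; exact: f1.
have p x : U x -> 0 < 1 - f x ^+ 2.
  by move=> /f1 /andP[? ?]; rewrite expr2; nra.
have s1 : smooth_on U (fun x => 1 - f x ^+ 2).
  have := smooth_onB oU (smooth_on_cst U (1 : R)) (smooth_onM oU sf sf).
  by congr smooth_on; apply/funext => x /=; rewrite expr2.
case=> [|k].
  exact: (@C0_on_comp1 _ _ _ (@asin R) (fun t => (Num.sqrt (1 - t ^+ 2))^-1)).
apply: (@Ck_on_comp1 _ _ _ _ (@asin R) (fun t => (Num.sqrt (1 - t ^+ 2))^-1)) => //.
apply: Ck_onV => //; first by move=> x Ux; rewrite gt_eqF // sqrtr_gt0 p.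
exact: (smooth_on_sqrt oU p s1 k).
Qed.

End smooth.

(** * Inverses of injective immersions *)

Section inverse.
Context {R : realType}.

(** Restricting [f] to the line through [c] in direction [v] reduces this to Fermat's rule in one
    variable. *)
Lemma diff_eq0_at_min (V : normedModType R) (f : V -> R) c v :
  (\forall x \near c, differentiable f x) -> (\forall x \near c, f c <= f x) ->
  'd f c v = 0.
Proof.
move=> df fmin.
pose l (t : R) : V := t *: v + c.
have l0 : l 0 = c by rewrite /l scale0r add0r.
have dl t : is_diff t l ( *:%R^~ v).
  by have := is_diffD (is_diff_scalel t v) (is_diff_cst c t); rewrite addr0.
have lc : {for 0, continuous l} by exact/differentiable_continuous/ex_diff.
have nl (P : V -> Prop) : (\forall x \near c, P x) -> \forall t \near 0, P (l t).
  by move=> cP; have /lc : nbhs (l 0) P by rewrite l0.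
have : \forall t \near 0, differentiable f (l t) /\ f c <= f (l t).
  apply: (nl (fun x => differentiable f x /\ f c <= f x)).
  by apply: filterS2 df fmin.
move=> /nbhs_ballP[e /= e0 He].
have Hi t : t \in `](- e), e[%R -> differentiable f (l t) /\ f c <= f (l t).
  by rewrite in_itv /= => te; apply: He; rewrite /ball /= sub0r normrN ltr_norml.
have e0' : 0 \in `](- e), e[%R by rewrite in_itv /= oppr_lt0 e0.
have [_ D0] : is_derive (0 : R) 1 (f \o l) 0.
  apply: (@derive1_at_min _ _ (- e) e) => //.
  - by rewrite ltW // gtrN.
  - move=> t /Hi [dt _]; apply/derivable1_diffP.
    by apply: differentiable_comp.
  - by move=> t /Hi [_]; rewrite /= l0.
have dfc : differentiable f (l 0) by have [] := Hi _ e0'.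
move: D0; rewrite deriveE; last exact: differentiable_comp.
have -> : 'd (f \o l) 0 1 = 'd f (l 0) ('d l 0 1) by rewrite diff_comp.
by rewrite [X in 'd f (l 0) X](_ : _ = v) ?l0 // diff_val scale1r.
Qed.

Lemma linear_injective_surjective N (f : {linear 'rV[R]_N -> 'rV[R]_N}) :
  injective f -> forall w, exists v, f v = w.
Proof.
move=> finj w.
have fE v : f v = v *m lin1_mx f by rewrite mul_rV_lin1.
have : row_free (lin1_mx f).
  rewrite -kermx_eq0; apply/eqP/row_matrixP => i; rewrite row0.
  by apply: finj; rewrite linear0 fE -row_mul mulmx_ker row0.
rewrite row_free_unit => fu; exists (w *m invmx (lin1_mx f)).
by rewrite fE mulmxKV.
Qed.

(** The squared Euclidean norm. The norm carried by row vectors is the maximum norm, which cannot be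
    differentiated in the minimisation argument below. *)
Definition sqnorm N (v : 'rV[R]_N) : R := \sum_j v ord0 j ^+ 2.

Lemma sqnorm_ge0 N (v : 'rV[R]_N) : 0 <= sqnorm v.
Proof. by apply: sumr_ge0 => j _; exact: sqr_ge0. Qed.

Lemma sqnorm_eq0 N (v : 'rV[R]_N) : sqnorm v = 0 -> v = 0.
Proof.
move=> /eqP; rewrite psumr_eq0; last by move=> j _; exact: sqr_ge0.
move=> /allP v0; apply/rowP => j; rewrite mxE; apply/eqP.
by have := v0 j (mem_index_enum j); rewrite sqrf_eq0.
Qed.

Lemma sqnormN N (v : 'rV[R]_N) : sqnorm (- v) = sqnorm v.
Proof. by apply: eq_bigr => j _; rewrite mxE sqrrN. Qed.

Lemma sqnormD_le N (u v : 'rV[R]_N) :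
  sqnorm (u + v) <= 2 * sqnorm u + 2 * sqnorm v.
Proof.
rewrite /sqnorm !mulr_sumr -big_split /=; apply: ler_sum => j _.
rewrite mxE; have := sqr_ge0 (u ord0 j - v ord0 j); nra.
Qed.

Definition row_coord N (j : 'I_N) (w : 'rV[R]_N) : R := w ord0 j.

Lemma row_coord_is_linear N (j : 'I_N) : linear (row_coord j).
Proof. by move=> a u v; rewrite /row_coord !mxE. Qed.

HB.instance Definition _ N (j : 'I_N) :=
  GRing.isLinear.Build R 'rV[R]_N R _ (row_coord j) (row_coord_is_linear j).

Lemma continuous_row_coord N (j : 'I_N) : continuous (row_coord j).
Proof. exact: coord_continuous. Qed.

Lemma is_diff_row_coord (V : normedModType R) N (j : 'I_N)
    (f : V -> 'rV[R]_N) x : differentiable f x ->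
  is_diff x (fun z => f z ord0 j) (fun v => 'd f x v ord0 j).
Proof.
move=> df; have cc := @continuous_row_coord _ j.
have dc y : differentiable (row_coord j) y by exact: linear_differentiable.
apply: DiffDef; first exact: (differentiable_comp df (dc _)).
by rewrite [LHS](diff_comp df (dc _)) diff_lin.
Qed.

Lemma is_diff_sqnorm N (V : normedModType R) (f : V -> 'rV[R]_N) x :
  differentiable f x ->
  is_diff x (fun z => sqnorm (f z))
    (fun v => \sum_j 2 * f x ord0 j * 'd f x v ord0 j).
Proof.
move=> df; pose c j z := f z ord0 j.
have dc j : is_diff x (c j) (fun v => 'd f x v ord0 j) by exact: is_diff_row_coord.
rewrite (_ : (fun z => _) = \sum_j (c j) ^+ 2); last first.
  by apply/funext => z; rewrite fct_sumE; apply: eq_bigr => j _.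
have H (s : seq 'I_N) : is_diff x (\sum_(j <- s) (c j) ^+ 2)
   (\sum_(j <- s) (fun v => 2 * f x ord0 j * 'd f x v ord0 j)).
  elim: s => [|j s IH]; first by rewrite !big_nil; exact: is_diff_cst.
  rewrite !big_cons; apply: is_diff_eq.
  by congr (_ + _); apply/funext => v; rewrite expr1.
apply: is_diff_eq.
by apply/funext => v; rewrite fct_sumE.
Qed.

(* Openness at [x0] by minimising the distance to a prescribed value over a
   compact ball: at an interior minimum the surjective differential forces the
   value to be attained. *)
Lemma injective_inverse_near N (U : set 'rV[R]_N) (f : 'rV[R]_N -> 'rV[R]_N) x0 :
  open U -> (forall x, U x -> differentiable f x) ->
  (forall x, U x -> injective ('d f x)) ->
  (forall x y, U x -> U y -> f x = f y -> x = y) -> U x0 ->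
  forall A, nbhs x0 A -> exists2 B, nbhs (f x0) B & forall x, U x -> B (f x) -> A x.
Proof.
move=> oU df dfi fi Ux0 A nA.
have [e e0 He] : exists2 e : R, 0 < e &
    forall x, `|x - x0| <= e -> U x /\ A x.
  have nUA : nbhs x0 (U `&` A) by apply: filterI => //; exact: open_nbhs_nbhs.
  move/nbhs_ballP : nUA => [d /= d0 Hd]; exists (d / 2); first by rewrite divr_gt0.
  move=> x xd; apply: Hd; rewrite -ball_normE /= distrC.
  by rewrite (le_lt_trans xd) // ltr_pdivrMr // ltr_pMr // ltr1n.
pose K := [set x : 'rV[R]_N | `|x - x0| <= e].
pose S := [set x : 'rV[R]_N | `|x - x0| = e].
have cN : continuous (fun x : 'rV[R]_N => `|x - x0|).
  move=> x; apply: continuous_comp; last exact: norm_continuous.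
  by apply: continuousB => //; exact: cst_continuous.
have bK (T : set 'rV[R]_N) : T `<=` K -> bounded_set T.
  move=> TK; exists (`|x0| + e); split; first exact: num_real.
  move=> M HM x /TK /= xe; apply: ltW; apply: le_lt_trans HM.
  by rewrite -[x](subrK x0) addrC (le_trans (ler_normD _ _)) // lerD2l.
have SK : S `<=` K by move=> x; rewrite /S /K /= => ->.
have cK : compact K.
  apply: bounded_closed_compact; first exact: bK.
  rewrite (_ : K = (fun x => `|x - x0|) @^-1` [set t | t <= e]) //.
  by apply: preimage_closed; [move=> x _; exact: cN|exact: closed_le].
have cS : compact S.
  apply: bounded_closed_compact; first exact: bK.
  rewrite (_ : S = (fun x => `|x - x0|) @^-1` [set t | t = e]) //.
  by apply: preimage_closed; [move=> x _; exact: cN|exact: closed_eq].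
have dpsi y x : U x -> is_diff x (fun z => sqnorm (f z - y))
    (fun v => \sum_j 2 * (f x - y) ord0 j * 'd f x v ord0 j).
  move=> Ux; have dfx := df x Ux.
  have dfy : is_diff x (fun z => f z - y) ('d f x).
    have := is_diffB (differentiableP dfx) (is_diff_cst y x).
    by rewrite subr0.
  have := @is_diff_sqnorm N _ _ x (@ex_diff _ _ _ _ _ _ _ dfy).
  by rewrite [in X in X -> _](diff_val (is_diff_def := dfy)).
have cpsi y (T : set 'rV[R]_N) : T `<=` K ->
    {within T, continuous (fun z => sqnorm (f z - y))}.
  move=> TK; apply/continuous_in_subspaceT => x; rewrite inE => /TK /He[Ux _].
  by apply: differentiable_continuous; have [] := dpsi y x Ux.
have [m m0 Hm] : exists2 m, 0 < m & forall x, S x -> m <= sqnorm (f x - f x0).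
  (* If the sphere is empty, as in dimension [0], any positive [m] serves. Otherwise the minimum
     over the sphere is positive because [f] is injective. *)
  have [[s Ss]|S0] := pselect (S !=set0); last first.
    by exists 1 => // x Sx; exfalso; apply: S0; exists x.
  have [c + Hc] := @compact_EVT_min _ R _ S (ex_intro _ s Ss) cS (cpsi (f x0) S SK).
  rewrite inE => Sc; exists (sqnorm (f c - f x0)); last first.
    by move=> x Sx; apply: Hc; rewrite inE.
  rewrite lt0r sqnorm_ge0 andbT; apply/eqP => /sqnorm_eq0 /subr0_eq fc.
  have [Uc _] := He c (SK c Sc).
  move: Sc; rewrite /S /= (fi _ _ Uc Ux0 fc) subrr normr0 => e00.
  by rewrite -e00 ltxx in e0.
(* Each application of [sqnormD_le] costs a factor [2]. If the minimiser [c] lay on the sphere, both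
   [f c] and [f x0] would be within [m / 4] of [f x1], so [f c] would be at squared distance less
   than [m] from [f x0]. *)
exists [set y | sqnorm (y - f x0) < m / 4].
  have cq : {for f x0, continuous (fun y : 'rV[R]_N => sqnorm (y - f x0))}.
    apply: differentiable_continuous.
    have dd : differentiable (fun y : 'rV[R]_N => y - f x0) (f x0).
      by apply: (@differentiableB _ _ _ id (cst _)).
    by have [] := is_diff_sqnorm dd.
  have := @cvgr_lt _ _ _ _ _ _ cq (m / 4); apply.
  rewrite subrr /sqnorm big1 ?divr_gt0 // => j _; by rewrite mxE expr0n.
move=> x1 Ux1 /= Bx1.
have Kx0 : K x0 by rewrite /K /= subrr normr0 ltW.
have [c + Hc] := @compact_EVT_min _ R _ K (ex_intro _ x0 Kx0) cK
  (cpsi (f x1) K (@subset_refl _ K)).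
rewrite inE => Kc.
have [Uc Ac] := He c Kc.
have ce : `|c - x0| < e.
  rewrite lt_neqAle; move: (Kc); rewrite /K /= => ->; rewrite andbT.
  apply/eqP => Sc; have := Hm c Sc.
  have := Hc x0; rewrite inE => /(_ Kx0).
  have := sqnormD_le (f c - f x1) (f x1 - f x0).
  rewrite addrA subrK -(sqnormN (f x0 - f x1)) opprB => h1 h2 h3.
  by move: Bx1 h1 h2 h3 m0; lra.
suff fc : f c = f x1 by rewrite -(fi _ _ Uc Ux1 fc).
have d0 v : 'd (fun z => sqnorm (f z - f x1)) c v = 0.
  apply: diff_eq0_at_min.
    by apply: filterS (open_nbhs_nbhs (conj oU Uc)) => x Ux; have [] := dpsi (f x1) x Ux.
  have : \forall x \near c, `|x - x0| < e.
    by have := @cvgr_lt _ _ _ _ _ _ (cN c) e; apply.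
  by apply: filterS => x xe; apply: Hc; rewrite inE /K /= ltW.
(* In a direction [v] that the differential sends to [f c - f x1], the squared distance has
   derivative twice its own value, so that value is zero. *)
have [v dv] := linear_injective_surjective (dfi c Uc) (f c - f x1).
apply/eqP; rewrite -subr_eq0; apply/eqP/sqnorm_eq0.
have := d0 v; have [_ ->] := dpsi (f x1) c Uc.
rewrite dv => h; have : 2 * sqnorm (f c - f x1) = 0.
  by rewrite -[RHS]h /sqnorm mulr_sumr; apply: eq_bigr => j _; rewrite expr2 mulrA.
by move=> /eqP; rewrite mulf_eq0 pnatr_eq0 => /eqP.
Qed.

(** Injectivity turns a choice of preimages into a left inverse. Off the image it takes the default
    value [0], which is harmless because continuity is asserted only within the image. *)
Lemma injective_immersion_inverse N (U : set 'rV[R]_N) (f : 'rV[R]_N -> 'rV[R]_N) :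
  open U -> (forall x, U x -> differentiable f x) ->
  (forall x, U x -> injective ('d f x)) ->
  (forall x y, U x -> U y -> f x = f y -> x = y) ->
  exists g : 'rV[R]_N -> 'rV[R]_N,
    {within f @` U, continuous g} /\ forall x, U x -> g (f x) = x.
Proof.
move=> oU df dfi fi.
pose g y := xget 0 [set x | U x /\ f x = y].
have gK x : U x -> g (f x) = x.
  move=> Ux; have [] := @xgetPex _ 0 [set z | U z /\ f z = f x] (ex_intro _ x (conj Ux erefl)).
  by rewrite -/(g (f x)) => Ug /(fi _ _ Ug Ux).
exists g; split=> //; apply/subspace_continuousP => _ [x0 Ux0 <-].
move=> A; have -> : from_subspace (f @` U) g (f x0) = x0 := gK _ Ux0.
move=> nA; have [B nB HB] := injective_inverse_near oU df dfi fi Ux0 nA.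
suff : \forall y \near f x0, (f @` U) y -> A (g y) by [].
apply: filterS nB => _ /[swap] -[x Ux <-] Bx.
by rewrite gK //; apply: HB.
Qed.

End inverse.

(** * Coordinates *)

Section coordinates.
Context {R : realType} {n : nat}.
Implicit Types (u v : 'rV[R]_(2 * n)) (i : 'I_n).

Lemma eq_coords u v : (forall i, xcoord u i = xcoord v i) ->
  (forall i, ycoord u i = ycoord v i) -> u = v.
Proof.
move=> hx hy; apply/rowP => j.
have hj : (j./2 < n)%N by rewrite ltn_half_double -mul2n.
have jE := odd_double_half j; rewrite -mul2n in jE.
have [jo|je] := boolP (odd j).
  have := hy (Ordinal hj); rewrite /ycoord.
  rewrite (_ : Ordinal (ypos_subproof _) = j) //.
  by apply/val_inj => /=; rewrite -[RHS]jE jo.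
have := hx (Ordinal hj); rewrite /xcoord.
rewrite (_ : Ordinal (xpos_subproof _) = j) //.
by apply/val_inj => /=; rewrite -[RHS]jE (negbTE je).
Qed.

Definition of_coords (X Y : 'I_n -> R) : 'rV[R]_(2 * n) :=
  \sum_i (X i *: delta_mx ord0 (Ordinal (xpos_subproof i)) +
          Y i *: delta_mx ord0 (Ordinal (ypos_subproof i))).

Lemma xcoord_of_coords X Y i : xcoord (of_coords X Y) i = X i.
Proof.
rewrite /xcoord /of_coords summxE (bigD1 i) //= big1 ?addr0.
  rewrite !mxE !eqxx /= mulr1 -val_eqE /= (_ : (2 * i == (2 * i).+1)%N = false).
    by rewrite mulr0 addr0.
  by lia.
move=> j /eqP ji; have {}ji : (j <> i :> nat) by move=> /val_inj.
rewrite !mxE /= -!val_eqE /= (_ : (2 * i == 2 * j)%N = false); last by lia.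
by rewrite (_ : (2 * i == (2 * j).+1)%N = false) ?mulr0 ?addr0 //; lia.
Qed.

Lemma ycoord_of_coords X Y i : ycoord (of_coords X Y) i = Y i.
Proof.
rewrite /ycoord /of_coords summxE (bigD1 i) //= big1 ?addr0.
  rewrite !mxE !eqxx /= mulr1 -val_eqE /= (_ : ((2 * i).+1 == (2 * i))%N = false).
    by rewrite mulr0 add0r.
  by lia.
move=> j /eqP ji; have {}ji : (j <> i :> nat) by move=> /val_inj.
rewrite !mxE /= -!val_eqE /= eqSS (_ : (2 * i == 2 * j)%N = false); last by lia.
by rewrite (_ : ((2 * i).+1 == (2 * j))%N = false) ?mulr0 ?addr0 //; lia.
Qed.

Lemma omega0_nondegenerate u : (forall v, omega0 u v = 0) -> u = 0.
Proof.
move=> h; apply: eq_coords => i.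
  have := h (of_coords (fun=> 0) (fun j => (j == i)%:R)).
  rewrite /omega0 (bigD1 i) //= big1 ?addr0.
    by rewrite xcoord_of_coords ycoord_of_coords eqxx mulr0 subr0 mulr1 /xcoord mxE.
  by move=> j ji; rewrite xcoord_of_coords ycoord_of_coords (negbTE ji) !mulr0 subr0.
have := h (of_coords (fun j => (j == i)%:R) (fun=> 0)).
rewrite /omega0 (bigD1 i) //= big1 ?addr0.
  rewrite xcoord_of_coords ycoord_of_coords eqxx mulr0 sub0r mulr1 => /eqP.
  by rewrite oppr_eq0 => /eqP ->; rewrite /ycoord mxE.
by move=> j ji; rewrite xcoord_of_coords ycoord_of_coords (negbTE ji) !mulr0 subr0.
Qed.

Lemma omega0B u u' v : omega0 (u - u') v = omega0 u v - omega0 u' v.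
Proof.
rewrite /omega0 -sumrB; apply: eq_bigr => i _.
by rewrite /xcoord /ycoord !mxE; ring.
Qed.

Lemma smooth_on_of_coords (V : normedModType R) (U : set V) (X Y : 'I_n -> V -> R) :
  open U -> (forall i, smooth_on U (X i)) -> (forall i, smooth_on U (Y i)) ->
  smooth_on U (fun z => of_coords (X^~ z) (Y^~ z)).
Proof.
move=> oU sX sY.
rewrite (_ : (fun z => _) = \sum_i ((fun z => X i z *: delta_mx ord0 (Ordinal (xpos_subproof i))) \+
          (fun z => Y i z *: delta_mx ord0 (Ordinal (ypos_subproof i))))); last first.
  by apply/funext => z; rewrite fct_sumE.
elim/big_ind : _ => [|f g sf sg|i _].
- exact: smooth_on_cst.
- exact: smooth_onD.
- by apply: smooth_onD => // k; apply: Ck_onZl => //; [exact: sX|exact: sY].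
Qed.

(** A map that preserves the nondegenerate form [omega0] has injective differentials, so immersivity
    and the continuity of the inverse come for free. What remains to check is smoothness, the
    two-form, injectivity and the target. *)
Lemma symplectic_embedding_of_coords (U T : set 'rV[R]_(2 * n))
    (X Y : 'I_n -> 'rV[R]_(2 * n) -> R) : open U ->
  (forall i, smooth_on U (X i)) -> (forall i, smooth_on U (Y i)) ->
  (forall x, U x -> forall u v, \sum_i ('d (X i) x u * 'd (Y i) x v -
     'd (Y i) x u * 'd (X i) x v) = omega0 u v) ->
  (forall x y, U x -> U y -> (forall i, X i x = X i y) ->
     (forall i, Y i x = Y i y) -> x = y) ->
  (forall x, U x -> T (of_coords (X^~ x) (Y^~ x))) ->
  symplectic_embedding U T (fun z => of_coords (X^~ z) (Y^~ z)).
Proof.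
move=> oU sX sY dXY inj XYT; set f := fun z => _.
have sf : smooth_on U f by exact: smooth_on_of_coords.
have df x : U x -> differentiable f x by move=> Ux; have [+ _] := sf 1%N; apply.
have fsymp x : U x -> forall u v, omega0 ('d f x u) ('d f x v) = omega0 u v.
  move=> Ux u v; rewrite -(dXY x Ux u v) /omega0; apply: eq_bigr => i _.
  have dX w : xcoord ('d f x w) i = 'd (X i) x w.
    have := is_diff_row_coord (Ordinal (xpos_subproof i)) (df x Ux).
    rewrite (_ : (fun z => _) = X i); first by move=> [_ ->].
    by apply/funext => z; exact: xcoord_of_coords.
  have dY w : ycoord ('d f x w) i = 'd (Y i) x w.
    have := is_diff_row_coord (Ordinal (ypos_subproof i)) (df x Ux).
    rewrite (_ : (fun z => _) = Y i); first by move=> [_ ->].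
    by apply/funext => z; exact: ycoord_of_coords.
  by rewrite !dX !dY.
have dfi x : U x -> injective ('d f x).
  move=> Ux u u' uu'; apply/eqP; rewrite -subr_eq0; apply/eqP.
  apply: omega0_nondegenerate => v.
  by rewrite omega0B -(fsymp x Ux u v) -(fsymp x Ux u' v) uu' subrr.
have fi x y : U x -> U y -> f x = f y -> x = y.
  move=> Ux Uy fxy; apply: inj => // i.
    by rewrite -[LHS](xcoord_of_coords (X^~ x) (Y^~ x)) -/(f x) fxy xcoord_of_coords.
  by rewrite -[LHS](ycoord_of_coords (X^~ x) (Y^~ x)) -/(f x) fxy ycoord_of_coords.
split=> //; last by move=> _ [x Ux <-]; exact: XYT.
split=> //; exact: injective_immersion_inverse.
Qed.

Lemma diff_xcoord i u v : 'd (fun z : 'rV[R]_(2 * n) => xcoord z i) u v = xcoord v i.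
Proof.
rewrite (_ : (fun z => _) = row_coord (Ordinal (xpos_subproof i))) //.
by rewrite diff_lin //; exact: continuous_row_coord.
Qed.

Lemma diff_ycoord i u v : 'd (fun z : 'rV[R]_(2 * n) => ycoord z i) u v = ycoord v i.
Proof.
rewrite (_ : (fun z => _) = row_coord (Ordinal (ypos_subproof i))) //.
by rewrite diff_lin //; exact: continuous_row_coord.
Qed.

Lemma smooth_on_xcoord i (U : set 'rV[R]_(2 * n)) : smooth_on U (fun z => xcoord z i).
Proof. move=> k; exact: Ck_on_linear (@continuous_row_coord _ _ _). Qed.

Lemma smooth_on_ycoord i (U : set 'rV[R]_(2 * n)) : smooth_on U (fun z => ycoord z i).
Proof. move=> k; exact: Ck_on_linear (@continuous_row_coord _ _ _). Qed.

Lemma open_ball_times_space m (r : R) : open (ball_times_space n m r).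
Proof.
have sU : smooth_on setT (fun z : 'rV[R]_(2 * n) =>
    \sum_(i < n | (i < m)%N) (xcoord z i ^+ 2 + ycoord z i ^+ 2)).
  rewrite (_ : (fun z => _) = \sum_(i < n | (i < m)%N)
     (((fun z => xcoord z i) \* (fun z => xcoord z i)) \+
      ((fun z => ycoord z i) \* (fun z => ycoord z i)))); last first.
    by apply/funext => z; rewrite fct_sumE; apply: eq_bigr => i _; rewrite !expr2.
  elim/big_ind : _ => [|f g sf sg|i _]; first exact: smooth_on_cst.
    by apply: smooth_onD => //; exact: openT.
  have oT := @openT 'rV[R]_(2 * n).
  by apply: smooth_onD => //; apply: smooth_onM => //;
    [exact: smooth_on_xcoord|exact: smooth_on_xcoord|
     exact: smooth_on_ycoord|exact: smooth_on_ycoord].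
apply: (@open_comp _ _ _ [set t : R | t < r ^+ 2]); last exact: open_lt.
by move=> z _; apply: (sU 0%N).
Qed.

End coordinates.

(** * Two-forms *)

Section diff_rules.
Context {R : realType} {V : normedModType R}.
Implicit Types (f g df dg : V -> R) (x : V).

(** The rules are restated for functions written pointwise, so that they chain into explicit
    differentials which [field] and [ring] can compare. *)
Lemma is_diff_cstE (c : R) x : is_diff x (fun _ : V => c) (fun _ => 0 : R).
Proof. exact: is_diff_cst. Qed.

Lemma is_diff_addE f g df dg x : is_diff x f df -> is_diff x g dg ->
  is_diff x (fun z => f z + g z) (fun v => df v + dg v).
Proof. exact: is_diffD. Qed.

Lemma is_diff_oppE f df x : is_diff x f df ->
  is_diff x (fun z => - f z) (fun v => - df v).
Proof. exact: is_diffN. Qed.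

Lemma is_diff_mulE f g df dg x : is_diff x f df -> is_diff x g dg ->
  is_diff x (fun z => f z * g z) (fun v => f x * dg v + g x * df v).
Proof. exact: is_diffM. Qed.

Lemma is_diff_comp1 (F : R -> R) (dF : R) f df x :
  is_derive (f x) 1 F dF -> is_diff x f df ->
  is_diff x (fun z => F (f z)) (fun v => dF * df v).
Proof.
by move=> dFx [dfx dfE]; have := diff_comp1 dFx dfx; rewrite dfE.
Qed.

Lemma is_diff_invE f df x : is_diff x f df -> f x != 0 ->
  is_diff x (fun z => (f z)^-1) (fun v => - ((f x)^-1 * (f x)^-1) * df v).
Proof.
by move=> dfx fx0; apply: is_diff_comp1 dfx; exact: is_derive1_inv.
Qed.

Lemma is_diff_cosE f df x : is_diff x f df ->
  is_diff x (fun z => cos (f z)) (fun v => - sin (f x) * df v).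
Proof. exact: is_diff_comp1. Qed.

Lemma is_diff_sinE f df x : is_diff x f df ->
  is_diff x (fun z => sin (f z)) (fun v => cos (f x) * df v).
Proof. exact: is_diff_comp1. Qed.

Lemma is_diff_sqrtE f df x : is_diff x f df -> 0 < f x ->
  is_diff x (fun z => Num.sqrt (f z)) (fun v => (2 * Num.sqrt (f x))^-1 * df v).
Proof. by move=> dfx fx0; apply: is_diff_comp1 dfx; exact: is_derive1_sqrt. Qed.

Lemma is_diff_asinE f df x : is_diff x f df -> -1 < f x < 1 ->
  is_diff x (fun z => asin (f z)) (fun v => (Num.sqrt (1 - f x ^+ 2))^-1 * df v).
Proof. by move=> dfx fx1; apply: is_diff_comp1 dfx; exact: is_derive1_asin. Qed.

Lemma ex_is_diff f x : differentiable f x -> exists df : V -> R, is_diff x f df.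
Proof. by move=> dfx; exists ('d f x); exact: differentiableP. Qed.

(** The value of the two-form [df /\ dg] at [x] on the vectors [u] and [v]. *)
Definition wedge f g x (u v : V) : R :=
  'd f x u * 'd g x v - 'd g x u * 'd f x v.

Lemma wedgeE f g df dg x u v : is_diff x f df -> is_diff x g dg ->
  wedge f g x u v = df u * dg v - dg u * df v.
Proof. by move=> [_ fE] [_ gE]; rewrite /wedge fE gE. Qed.

End diff_rules.

(** * The elementary maps: rectangle, strip, polar lift and torus *)

Section elementary.
Context {R : realType}.
Implicit Types (A s t K c d y p r : R).

(* [(rect_pos A, rect_mom A)] maps the open disc of squared radius [A] onto the
   rectangle of sides [1] and [pi * A] centred at [0], column by column, and
   [(strip_pos d, strip_mom d)] maps the plane onto the strip of width [2 * d]. *)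
Definition disc_angle A s : R := asin (s / Num.sqrt A).
Definition rect_pos A s : R :=
  (disc_angle A s + sin (disc_angle A s) * cos (disc_angle A s)) / pi.
Definition rect_mom A s t : R := t * (pi * Num.sqrt A / 2) / cos (disc_angle A s).

Definition strip_pos d s t : R :=
  s * (Num.sqrt (1 + t * t) * Num.sqrt (1 + t * t) * Num.sqrt (1 + t * t)) / d.
Definition strip_mom d t : R := d * t / Num.sqrt (1 + t * t).

(* Momenta of the cotangent lift of [(r, s) |-> (r cos s, r sin s)] at [(y, p)]. *)
Definition lift_cos r y s p : R := y * cos s - p / r * sin s.
Definition lift_sin r y s p : R := y * sin s + p / r * cos s.

(* Action-angle coordinates with action [K * (s + c)] and angle [t / K]. *)
Definition torus_x K c s t : R := Num.sqrt (2 * K * (s + c)) * cos (t / K).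
Definition torus_y K c s t : R := Num.sqrt (2 * K * (s + c)) * sin (t / K).

End elementary.

(** * The elementary maps preserve the two-form *)

Section wedge_elementary.
Context {R : realType} {V : normedModType R}.
Implicit Types (a b c d : V -> R) (x u v : V).

(** In polar coordinates the area form is half the differential of the squared radius, here
    [K * da], wedged with that of the angle, here [db / K]. *)
Lemma wedge_torus (K k : R) a b x u v : 0 < K -> 0 < a x + k ->
  differentiable a x -> differentiable b x ->
  wedge (fun z => torus_x K k (a z) (b z)) (fun z => torus_y K k (a z) (b z)) x u v
  = wedge a b x u v.
Proof.
move=> K0 ak /ex_is_diff[a' da] /ex_is_diff[b' db].
have dt := is_diff_mulE (is_diff_cstE (2 * K) x) (is_diff_addE da (is_diff_cstE k x)).
have t0 : 0 < 2 * K * (a x + k) by rewrite !mulr_gt0.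
have ds := is_diff_sqrtE dt t0.
have dth := is_diff_mulE db (is_diff_cstE K^-1 x).
have dX := is_diff_mulE ds (is_diff_cosE dth).
have dY := is_diff_mulE ds (is_diff_sinE dth).
rewrite (wedgeE _ _ dX dY) (wedgeE _ _ da db) /=.
set C := cos _; set S := sin _.
have CS : C ^+ 2 = 1 - S ^+ 2 by rewrite /C cos2sin2.
set q := Num.sqrt _.
have q0 : q != 0 by rewrite gt_eqF // sqrtr_gt0.
have K0' : K != 0 by rewrite gt_eqF.
clearbody C S q.
move: (a' u) (a' v) (b' u) (b' v) => au av bu bv.
by field: CS; rewrite K0' q0.
Qed.

(** A cotangent lift preserves the canonical one-form: momenta paired with the differentials of the
    Cartesian positions give [b * da + d * dc]. The proof checks the resulting two-form by expansion
    modulo [cos ^+ 2 + sin ^+ 2 = 1]. *)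
Lemma wedge_lift a b c d x u v : a x != 0 ->
  differentiable a x -> differentiable b x ->
  differentiable c x -> differentiable d x ->
  wedge (fun z => a z * cos (c z)) (fun z => lift_cos (a z) (b z) (c z) (d z)) x u v +
  wedge (fun z => a z * sin (c z)) (fun z => lift_sin (a z) (b z) (c z) (d z)) x u v
  = wedge a b x u v + wedge c d x u v.
Proof.
move=> a0 /ex_is_diff[a' da] /ex_is_diff[b' db] /ex_is_diff[c' dc] /ex_is_diff[d' dd].
have dcos := is_diff_cosE dc; have dsin := is_diff_sinE dc.
have dP := is_diff_mulE dd (is_diff_invE da a0).
have dX := is_diff_mulE da dcos.
have dX' := is_diff_mulE da dsin.
have dY := is_diff_addE (is_diff_mulE db dcos) (is_diff_oppE (is_diff_mulE dP dsin)).
have dY' := is_diff_addE (is_diff_mulE db dsin) (is_diff_mulE dP dcos).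
rewrite (wedgeE _ _ dX dY) (wedgeE _ _ dX' dY') (wedgeE _ _ da db) (wedgeE _ _ dc dd) /=.
set C := cos _; set S := sin _.
have CS : C ^+ 2 = 1 - S ^+ 2 by rewrite /C cos2sin2.
clearbody C S; move: a0.
move: (a x) (b x) (d x) (a' u) (a' v) (b' u) (b' v) (c' u) (c' v) (d' u) (d' v).
by move=> r y p au av bu bv cu cv du dv r0; field: CS.
Qed.

(** The derivative of [strip_mom k] at [t] is [k] over the cube of the root of [1 + t * t], and
    [strip_pos] divides the position by exactly this. *)
Lemma wedge_strip (k : R) a b x u v : 0 < k ->
  differentiable a x -> differentiable b x ->
  wedge (fun z => strip_pos k (a z) (b z)) (fun z => strip_mom k (b z)) x u v
  = wedge a b x u v.
Proof.
move=> k0 /ex_is_diff[a' da] /ex_is_diff[b' db].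
have db2 := is_diff_addE (is_diff_cstE 1 x) (is_diff_mulE db db).
have w0 : 0 < 1 + b x * b x by nra.
have dw := is_diff_sqrtE db2 w0.
have w1 : Num.sqrt (1 + b x * b x) != 0 by rewrite gt_eqF // sqrtr_gt0.
have dX := is_diff_mulE (is_diff_mulE da (is_diff_mulE (is_diff_mulE dw dw) dw))
  (is_diff_cstE k^-1 x).
have dY := is_diff_mulE (is_diff_mulE (is_diff_cstE k x) db) (is_diff_invE dw w1).
rewrite (wedgeE _ _ dX dY) (wedgeE _ _ da db) /=.
have : Num.sqrt (1 + b x * b x) ^+ 2 = 1 + b x * b x by rewrite sqr_sqrtr // ltW.
move: w1; set q := Num.sqrt _ => q0 q2.
have k0' : k != 0 by rewrite gt_eqF.
clearbody q.
move: (a' u) (a' v) (b' u) (b' v) (a x) => au av bu bv ax.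
by field: q2; rewrite k0' q0.
Qed.

(** This is the shear generated by the product of the two positions [a] and [c]; the extra terms
    [da /\ dc] and [dc /\ da] cancel. *)
Lemma wedge_shear a b c d x u v : differentiable a x -> differentiable b x ->
  differentiable c x -> differentiable d x ->
  wedge a (fun z => b z + c z) x u v + wedge c (fun z => d z + a z) x u v =
  wedge a b x u v + wedge c d x u v.
Proof.
move=> /ex_is_diff[a' da] /ex_is_diff[b' db] /ex_is_diff[c' dc] /ex_is_diff[d' dd].
rewrite (wedgeE _ _ da (is_diff_addE db dc)) (wedgeE _ _ dc (is_diff_addE dd da)).
by rewrite (wedgeE _ _ da db) (wedgeE _ _ dc dd); ring.
Qed.

Lemma wedge_shift a b (k : R) x u v : differentiable a x -> differentiable b x ->
  wedge (fun z => a z + k) b x u v = wedge a b x u v.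
Proof.
move=> /ex_is_diff[a' da] /ex_is_diff[b' db].
by rewrite (wedgeE _ _ (is_diff_addE da (is_diff_cstE k x)) db) (wedgeE _ _ da db) !addr0.
Qed.

End wedge_elementary.

(** * Ranges and injectivity of the elementary maps *)

Section elementary_theory.
Context {R : realType}.
Implicit Types (A s t K c d y p r : R).

(** The derivative is [2 * cos a ^+ 2], positive inside the interval. The endpoints are included so
    that the range of [rect_pos] can be read off there. *)
Lemma angle_sum_mono :
  {in `[- (pi / 2), pi / 2]%R &, {homo (fun a : R => a + sin a * cos a) : a b / a < b}}.
Proof.
set f := fun a : R => a + sin a * cos a.
have D (a : R) : is_derive a 1 f (2 * cos a ^+ 2).
  have := is_diff_addE (is_diff_id a)
    (is_diff_mulE (is_diff_sinE (is_diff_id a)) (is_diff_cosE (is_diff_id a))).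
  move=> [df dfE]; apply: DeriveDef; first exact/derivable1_diffP.
  rewrite deriveE // dfE /=; have := cos2Dsin2 a; rewrite !expr2; lra.
apply: gtr0_derive1_lt_cc.
- by move=> a _; have [] := D a.
- move=> a; rewrite in_itv /= => ha; rewrite derive1E derive_val.
  by rewrite mulr_gt0 // exprn_gt0 // cos_gt0_pihalf.
- apply: continuous_subspaceT => a.
  by apply/differentiable_continuous/derivable1_diffP; have [] := D a.
Qed.

(** For [t] the distance of the angles, the hypotheses give [cos t = 1], so [sin (t / 2) = 0] by the
    double-angle formula; this is impossible when [t / 2] lies strictly between [0] and [pi]. *)
Lemma circle_inj (a b : R) : cos a = cos b -> sin a = sin b ->
  `|a - b| < 2 * pi -> a = b.
Proof.
move=> hc hs hab.
have h1 : cos `|a - b| = 1.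
  by rewrite cos_norm cosB hc hs -!expr2 cos2Dsin2.
set t := `|a - b| in hab h1.
have /orP[/eqP t0|t0] : (0 == t) || (0 < t) by rewrite -le_eqVlt normr_ge0.
  by apply/eqP; rewrite -subr_eq0 -normr_eq0 -/t -t0.
have : 0 < sin (t / 2) by apply: sin_gt0_pi; lra.
have := cosD (t / 2) (t / 2); rewrite -splitr h1.
have := cos2Dsin2 (t / 2); rewrite !expr2; nra.
Qed.

Section disc.
Variables A s t : R.
Hypotheses (A0 : 0 < A) (stA : s ^+ 2 + t ^+ 2 < A).
Let q := Num.sqrt A.
Let q0 : 0 < q. Proof. by rewrite sqrtr_gt0. Qed.
Let q2 : q ^+ 2 = A. Proof. by rewrite sqr_sqrtr // ltW. Qed.

Lemma disc_ratio_lt1 : -1 < s / q < 1.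
Proof.
have s1 : s ^+ 2 < q ^+ 2 by rewrite q2; apply: le_lt_trans stA; rewrite lerDl sqr_ge0.
rewrite ltr_pdivlMr // ltr_pdivrMr // mulN1r mul1r.
by rewrite -ltr_norml -ltr_sqr ?nnegrE ?normr_ge0 ?ltW // real_normK ?num_real.
Qed.

Lemma disc_angle_itv : - (pi / 2) < disc_angle A s < pi / 2.
Proof.
have /andP[h1 h2] := disc_ratio_lt1; rewrite /disc_angle -/q.
by rewrite asin_gtNpi2 ?asin_ltpi2 // ?h1 ?h2 ltW.
Qed.

Lemma sin_disc_angle : sin (disc_angle A s) = s / q.
Proof.
have /andP[h1 h2] := disc_ratio_lt1.
by rewrite /disc_angle asinK // in_itv /= !ltW.
Qed.

Lemma cos_disc_angle_gt0 : 0 < cos (disc_angle A s).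
Proof. exact/cos_gt0_pihalf/disc_angle_itv. Qed.

Lemma rect_pos_itv : - (1 / 2) < rect_pos A s < 1 / 2.
Proof.
have /andP[h1 h2] := disc_angle_itv.
have p0 := pi_gt0 R.
have e1 : pi / 2 \in `[- (pi / 2), pi / 2 : R]%R by rewrite in_itv /=; lra.
have e2 : - (pi / 2) \in `[- (pi / 2), pi / 2 : R]%R by rewrite in_itv /=; lra.
have e3 : disc_angle A s \in `[- (pi / 2), pi / 2 : R]%R by rewrite in_itv /=; lra.
have := angle_sum_mono e2 e3 h1; have := angle_sum_mono e3 e1 h2.
rewrite /rect_pos cosN cos_pihalf !mulr0 !addr0 => g1 g2.
rewrite ltr_pdivlMr // ltr_pdivrMr //; lra.
Qed.

Lemma rect_mom_itv : `|rect_mom A s t| < pi * A / 2.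
Proof.
have c0 := cos_disc_angle_gt0; have p0 := pi_gt0 R.
rewrite /rect_mom -/q; set C := cos _ in c0 *.
rewrite normrM normfV (gtr0_norm c0) ltr_pdivrMr // normrM.
rewrite (gtr0_norm (_ : 0 < pi * q / 2)); last by rewrite !mulr_gt0.
have CE : C ^+ 2 = 1 - (s / q) ^+ 2 by rewrite cos2sin2 sin_disc_angle.
have qC : (q * C) ^+ 2 = q ^+ 2 - s ^+ 2.
  by rewrite exprMn CE; field; rewrite gt_eqF.
(* [q * C] is half the length of the column of the disc over [s]. *)
have tq : `|t| < q * C.
  rewrite -ltr_sqr ?nnegrE ?normr_ge0 ?mulr_ge0 ?ltW //.
  by rewrite real_normK ?num_real // qC q2 ltrBrDl.
rewrite -q2; have -> : pi * q ^+ 2 / 2 * C = (q * C) * (pi * q / 2) by ring.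
by rewrite ltr_pM2r // !mulr_gt0.
Qed.

End disc.

Lemma rect_inj A s t s' t' : 0 < A -> s ^+ 2 + t ^+ 2 < A -> s' ^+ 2 + t' ^+ 2 < A ->
  rect_pos A s = rect_pos A s' -> rect_mom A s t = rect_mom A s' t' ->
  s = s' /\ t = t'.
Proof.
move=> A0 h h' e1 e2.
have /andP[h1 h2] := disc_angle_itv A0 h.
have /andP[h3 h4] := disc_angle_itv A0 h'.
have p0 := pi_gt0 R.
have q0 : Num.sqrt A != 0 by rewrite gt_eqF // sqrtr_gt0.
have e : disc_angle A s = disc_angle A s'.
  move: e1 => /(mulIf (invr_neq0 (lt0r_neq0 p0))) e1.
  have i1 : disc_angle A s \in `[- (pi / 2), pi / 2 : R]%R by rewrite in_itv /=; lra.
  have i2 : disc_angle A s' \in `[- (pi / 2), pi / 2 : R]%R by rewrite in_itv /=; lra.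
  have [l|l|//] := ltgtP (disc_angle A s) (disc_angle A s').
    by have := angle_sum_mono i1 i2 l; rewrite e1 ltxx.
  by have := angle_sum_mono i2 i1 l; rewrite e1 ltxx.
have ss : s = s'.
  have := sin_disc_angle A0 h; rewrite e (sin_disc_angle A0 h') => /eqP.
  by rewrite eq_sym (inj_eq (mulIf (invr_neq0 q0))) => /eqP.
split=> //; have c0 := cos_disc_angle_gt0 A0 h.
move: e2; rewrite /rect_mom -ss => /(mulIf _) e2.
apply: (mulIf (_ : pi * Num.sqrt A / 2 != 0)).
  by rewrite gt_eqF // !mulr_gt0 // sqrtr_gt0.
by apply: e2; rewrite invr_eq0 gt_eqF.
Qed.

Lemma strip_mom_lt d t : 0 < d -> `|strip_mom d t| < d.
Proof.
move=> d0; rewrite /strip_mom.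
have w0 : 0 < 1 + t * t by nra.
have q0 : 0 < Num.sqrt (1 + t * t) by rewrite sqrtr_gt0.
rewrite normrM normfV (gtr0_norm q0) ltr_pdivrMr // normrM (gtr0_norm d0) ltr_pM2l //.
rewrite -sqrtr_sqr ltr_sqrt // expr2; lra.
Qed.

Lemma strip_inj d s t s' t' : 0 < d ->
  strip_pos d s t = strip_pos d s' t' -> strip_mom d t = strip_mom d t' ->
  s = s' /\ t = t'.
Proof.
move=> d0 + e2; have d0' : d != 0 by rewrite gt_eqF.
have w0 : 0 < 1 + t * t by nra.
have w0' : 0 < 1 + t' * t' by nra.
have q0 : 0 < Num.sqrt (1 + t * t) by rewrite sqrtr_gt0.
have q0' : 0 < Num.sqrt (1 + t' * t') by rewrite sqrtr_gt0.
have q2 : Num.sqrt (1 + t * t) ^+ 2 = 1 + t * t by rewrite sqr_sqrtr // ltW.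
have q2' : Num.sqrt (1 + t' * t') ^+ 2 = 1 + t' * t' by rewrite sqr_sqrtr // ltW.
have tt : t = t'.
  move: e2; rewrite /strip_mom.
  move: q0 q0' q2 q2'; set q := Num.sqrt _; set q' := Num.sqrt _ => q0 q0' q2 q2' e2.
  have e3 : t * q' = t' * q.
    apply: (mulfI d0'); apply: (mulIf (invr_neq0 (lt0r_neq0 q0))).
    apply: (mulIf (invr_neq0 (lt0r_neq0 q0'))).
    rewrite [LHS](_ : _ = d * t / q); last by field; rewrite !gt_eqF.
    by rewrite e2; field; rewrite !gt_eqF.
  have e4 : t ^+ 2 = t' ^+ 2.
    have : (t * q') ^+ 2 = (t' * q) ^+ 2 by rewrite e3.
    by rewrite !exprMn q2 q2'; rewrite !expr2; lra.
  have qq : q = q' by rewrite /q /q' -!expr2 e4.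
  by move: e3; rewrite qq => /(mulIf (lt0r_neq0 q0')).
rewrite /strip_pos tt => /(mulIf (invr_neq0 d0')) e1; split=> //.
by apply: (mulIf _ e1); rewrite !mulf_neq0 // gt_eqF.
Qed.

Lemma torus_sqr K c s t : 0 < K -> 0 < s + c ->
  torus_x K c s t ^+ 2 + torus_y K c s t ^+ 2 = 2 * K * (s + c).
Proof.
move=> K0 sc; rewrite /torus_x /torus_y !exprMn -mulrDr cos2Dsin2 mulr1 sqr_sqrtr //.
by rewrite ltW // !mulr_gt0.
Qed.

Lemma torus_inj_pos K c s t s' t' : 0 < K -> 0 < s + c -> 0 < s' + c ->
  torus_x K c s t = torus_x K c s' t' -> torus_y K c s t = torus_y K c s' t' ->
  s = s'.
Proof.
move=> K0 sc sc' e1 e2; have := torus_sqr t K0 sc.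
rewrite e1 e2 (torus_sqr t' K0 sc') => /(mulfI _) => h.
by apply/esym/(addIr c)/h; rewrite mulf_neq0 ?gt_eqF.
Qed.

Lemma torus_inj_angle K c s t t' : 0 < K -> 0 < s + c -> `|t - t'| < 2 * pi * K ->
  torus_x K c s t = torus_x K c s t' -> torus_y K c s t = torus_y K c s t' ->
  t = t'.
Proof.
move=> K0 sc tt; rewrite /torus_x /torus_y.
have q0 : Num.sqrt (2 * K * (s + c)) != 0 by rewrite gt_eqF // sqrtr_gt0 !mulr_gt0.
move=> /(mulfI q0) e1 /(mulfI q0) e2.
have K0' : K^-1 != 0 by rewrite invr_eq0 gt_eqF.
apply: (mulIf K0'); apply: circle_inj => //.
by rewrite -mulrBl normrM normfV (gtr0_norm K0) ltr_pdivrMr.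
Qed.

(** Over a fixed base point the lift rotates the vector [(y, p / r)] by the angle [a], hence is an
    isometry of the fibre. *)
Lemma lift_dist r y a p y' p' :
  (lift_cos r y a p - lift_cos r y' a p') ^+ 2 +
  (lift_sin r y a p - lift_sin r y' a p') ^+ 2 =
  (y - y') ^+ 2 + ((p - p') / r) ^+ 2.
Proof.
rewrite /lift_cos /lift_sin mulrBl; set P := p / r; set P' := p' / r.
have := cos2sin2 a; set C := cos a; set S := sin a => CS.
by ring: CS.
Qed.

(** The angles are real numbers and are recovered here only up to full turns; the sheared coordinate
    [p2 + a] removes this ambiguity in [wrapping_inj]. *)
Lemma polar_inj r a r' a' : 0 < r -> 0 < r' -> r * cos a = r' * cos a' ->
  r * sin a = r' * sin a' -> [/\ r = r', cos a = cos a' & sin a = sin a'].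
Proof.
move=> r0 r0' e1 e2.
have e : r = r'.
  have : r ^+ 2 = r' ^+ 2.
    rewrite -[LHS]mulr1 -(cos2Dsin2 a) mulrDr -!exprMn e1 e2 !exprMn -mulrDr.
    by rewrite cos2Dsin2 mulr1.
  by move/eqP; rewrite eqrXn2 ?ltW // => /eqP.
have r1 : r' != 0 by rewrite gt_eqF.
by move: e1 e2; rewrite e => /(mulfI r1) ? /(mulfI r1) ?.
Qed.

End elementary_theory.

(** * Smoothness of the elementary maps *)

Section smooth_elementary.
Context {R : realType} {V : normedModType R} (U : set V) (oU : open U).
Implicit Types (a b c d : V -> R).

Lemma smooth_on_cos a : smooth_on U a -> smooth_on U (fun z => cos (a z)).
Proof. by move=> sa; have [] := smooth_on_trig oU sa. Qed.

Lemma smooth_on_sin a : smooth_on U a -> smooth_on U (fun z => sin (a z)).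
Proof. by move=> sa; have [] := smooth_on_trig oU sa. Qed.

Lemma smooth_on_div a b : (forall z, U z -> b z != 0) -> smooth_on U a ->
  smooth_on U b -> smooth_on U (fun z => a z / b z).
Proof. by move=> b0 sa sb; apply: smooth_onM => //; exact: smooth_onV. Qed.

Lemma smooth_on_divc a (k : R) : smooth_on U a -> smooth_on U (fun z => a z / k).
Proof. by move=> sa; apply: smooth_onM => //; exact: smooth_on_cst. Qed.

Lemma smooth_on_mulc a (k : R) : smooth_on U a -> smooth_on U (fun z => k * a z).
Proof. by move=> sa; apply: smooth_onM => //; exact: smooth_on_cst. Qed.

Lemma smooth_on_addc a (k : R) : smooth_on U a -> smooth_on U (fun z => a z + k).
Proof. by move=> sa; apply: smooth_onD => //; exact: smooth_on_cst. Qed.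

Section disc.
Variables (A : R) (a b : V -> R).
Hypotheses (A0 : 0 < A) (abA : forall z, U z -> a z ^+ 2 + b z ^+ 2 < A).
Hypotheses (sa : smooth_on U a) (sb : smooth_on U b).

Lemma smooth_on_disc_angle : smooth_on U (fun z => disc_angle A (a z)).
Proof.
apply: smooth_on_asin => //; last exact: smooth_on_divc.
by move=> z Uz; exact: disc_ratio_lt1 (abA Uz).
Qed.

Lemma smooth_on_rect_pos : smooth_on U (fun z => rect_pos A (a z)).
Proof.
have sd := smooth_on_disc_angle.
apply: smooth_on_divc; apply: smooth_onD => //; apply: smooth_onM => //.
  exact: smooth_on_sin.
exact: smooth_on_cos.
Qed.

Lemma smooth_on_rect_mom : smooth_on U (fun z => rect_mom A (a z) (b z)).
Proof.
apply: smooth_on_div.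
- by move=> z Uz; rewrite gt_eqF // (cos_disc_angle_gt0 A0 (abA Uz)).
- by apply: smooth_onM => //; exact: smooth_on_cst.
- exact/smooth_on_cos/smooth_on_disc_angle.
Qed.

(** [rect_pos] is the signed fraction of the disc's area between the central column and the one over
    [s]. Its derivative is therefore proportional to the column length, and is the reciprocal of the
    factor by which [rect_mom] stretches that column. *)
Lemma wedge_rect x u v : U x ->
  wedge (fun z => rect_pos A (a z)) (fun z => rect_mom A (a z) (b z)) x u v
  = wedge a b x u v.
Proof.
move=> Ux.
have /ex_is_diff[a' da] : differentiable a x by have [+ _] := sa 1%N; apply.
have /ex_is_diff[b' db] : differentiable b x by have [+ _] := sb 1%N; apply.
have q0 : 0 < Num.sqrt A by rewrite sqrtr_gt0.
have c0 := cos_disc_angle_gt0 A0 (abA Ux).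
have sE := sin_disc_angle A0 (abA Ux).
have dq := is_diff_mulE da (is_diff_cstE (Num.sqrt A)^-1 x).
have dth := is_diff_asinE dq (disc_ratio_lt1 A0 (abA Ux)).
have := dth; rewrite -/(disc_angle A (a x)) => dth'.
have cE : Num.sqrt (1 - (a x / Num.sqrt A) ^+ 2) = cos (disc_angle A (a x)).
  rewrite -sE -cos2sin2 sqrtr_sqr gtr0_norm //.
rewrite cE in dth'.
have c1 : cos (disc_angle A (a x)) != 0 by rewrite gt_eqF.
have dX := is_diff_mulE (is_diff_addE dth' (is_diff_mulE (is_diff_sinE dth') (is_diff_cosE dth')))
  (is_diff_cstE pi^-1 x).
have dY := is_diff_mulE (is_diff_mulE db (is_diff_cstE (pi * Num.sqrt A / 2) x))
  (is_diff_invE (is_diff_cosE dth') c1).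
rewrite (wedgeE _ _ dX dY) (wedgeE _ _ da db) /= -/(disc_angle A (a x)).
have := cos2sin2 (disc_angle A (a x)).
move: c1; set C := cos _; set S := sin _ => c1 CS.
have p0 : pi != 0 :> R by rewrite gt_eqF // pi_gt0.
have q1 : Num.sqrt A != 0 by rewrite gt_eqF.
move: p0 q1; generalize (pi : R), (Num.sqrt A) => P q p0 q1.
by field: CS; rewrite p0 q1 c1.
Qed.

End disc.

Lemma sqrt1sqr_gt0 (t : R) : 0 < Num.sqrt (1 + t * t).
Proof. by rewrite sqrtr_gt0; nra. Qed.

Lemma smooth_on_sqrt1sqr a : smooth_on U a -> smooth_on U (fun z => Num.sqrt (1 + a z * a z)).
Proof.
move=> sa; apply: smooth_on_sqrt => //; first by move=> z _; nra.
by apply: smooth_onD => //; [exact: smooth_on_cst|exact: smooth_onM].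
Qed.

Lemma smooth_on_strip_pos (k : R) a b : smooth_on U a -> smooth_on U b ->
  smooth_on U (fun z => strip_pos k (a z) (b z)).
Proof.
move=> sa sb; have sw := smooth_on_sqrt1sqr sb.
by apply: smooth_on_divc; do 3 (apply: smooth_onM => //).
Qed.

Lemma smooth_on_strip_mom (k : R) b : smooth_on U b ->
  smooth_on U (fun z => strip_mom k (b z)).
Proof.
move=> sb; apply: smooth_on_div.
- by move=> z _; rewrite gt_eqF // sqrt1sqr_gt0.
- exact: smooth_on_mulc.
- exact: smooth_on_sqrt1sqr.
Qed.

Section lift.
Variables a b c d : V -> R.
Hypothesis a0 : forall z, U z -> a z != 0.
Hypotheses (sa : smooth_on U a) (sb : smooth_on U b) (sc : smooth_on U c) (sd : smooth_on U d).

Lemma smooth_on_lift_cos : smooth_on U (fun z => lift_cos (a z) (b z) (c z) (d z)).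
Proof.
have sC := smooth_on_cos sc; have sS := smooth_on_sin sc.
have sP := smooth_on_div a0 sd sa.
by apply: smooth_onB => //; apply: smooth_onM.
Qed.

Lemma smooth_on_lift_sin : smooth_on U (fun z => lift_sin (a z) (b z) (c z) (d z)).
Proof.
have sC := smooth_on_cos sc; have sS := smooth_on_sin sc.
have sP := smooth_on_div a0 sd sa.
by apply: smooth_onD => //; apply: smooth_onM.
Qed.

End lift.

Section torus.
Variables (K k : R) (a b : V -> R).
Hypotheses (K0 : 0 < K) (ak : forall z, U z -> 0 < a z + k).
Hypotheses (sa : smooth_on U a) (sb : smooth_on U b).

Let smooth_radius : smooth_on U (fun z => Num.sqrt (2 * K * (a z + k))).
Proof.
apply: smooth_on_sqrt => //; first by move=> z Uz; rewrite !mulr_gt0 // ak.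
exact/smooth_on_mulc/smooth_on_addc.
Qed.

Lemma smooth_on_torus_x : smooth_on U (fun z => torus_x K k (a z) (b z)).
Proof. by apply: smooth_onM => //; exact/smooth_on_cos/smooth_on_divc. Qed.

Lemma smooth_on_torus_y : smooth_on U (fun z => torus_y K k (a z) (b z)).
Proof. by apply: smooth_onM => //; exact/smooth_on_sin/smooth_on_divc. Qed.

End torus.

End smooth_elementary.

(** * One step *)

Section wrapping.
Context {R : realType}.
Variables A rho : R.
Hypotheses (A0 : 0 < A) (rho0 : 0 < rho).

Lemma polar_itv (r a : R) : rho < r < 1 + rho ->
  (- (1 + rho) < r * cos a < 1 + rho) /\ (- (1 + rho) < r * sin a < 1 + rho).
Proof.
move=> /andP[h1 h2].
have := cos_geN1 a; have := cos_le1 a; have := sin_geN1 a; have := sin_le1 a.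
move: (cos a) (sin a) rho0 => C S r0 s1 s2 c1 c2.
by split; apply/andP; split; nra.
Qed.

(* The fibre coordinates are read modulo [2 * pi * K = pi * A * (1 + rho)] in each
   direction; rotating by the base angle is an isometry, so two fibre points over
   the same base point are too close to differ by a nonzero lattice vector. *)
Lemma wrapping_inj (r y a p q p2 r' y' a' p' q' p2' : R) :
  let K := A * (1 + rho) / 2 in let k := pi * A * rho ^+ 2 / 2 in
  let c := 1 + rho in
  rho < r < 1 + rho -> rho < r' < 1 + rho ->
  `|y| < pi * A / 2 -> `|y'| < pi * A / 2 -> `|p| < k -> `|p'| < k ->
  `|p2| < pi -> `|p2'| < pi ->
  torus_x K c (r * cos a) (lift_cos r y a (p + q)) =
    torus_x K c (r' * cos a') (lift_cos r' y' a' (p' + q')) ->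
  torus_y K c (r * cos a) (lift_cos r y a (p + q)) =
    torus_y K c (r' * cos a') (lift_cos r' y' a' (p' + q')) ->
  torus_x K c (r * sin a) (lift_sin r y a (p + q)) =
    torus_x K c (r' * sin a') (lift_sin r' y' a' (p' + q')) ->
  torus_y K c (r * sin a) (lift_sin r y a (p + q)) =
    torus_y K c (r' * sin a') (lift_sin r' y' a' (p' + q')) ->
  q = q' -> p2 + a = p2' + a' ->
  [/\ r = r', y = y', a = a', p = p' & p2 = p2'].
Proof.
move=> K k c hr hr' hy hy' hp hp' hp2 hp2' x0 y0 x1 y1 eq_q eq_p2.
have pi0 := pi_gt0 R.
have K0 : 0 < K by rewrite /K !mulr_gt0 // ltr_wpDl.
have [/andP[b1 b2] /andP[b3 b4]] := polar_itv a hr.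
have [/andP[b1' b2'] /andP[b3' b4']] := polar_itv a' hr'.
have r0 : 0 < r by case/andP: hr => h _; exact: lt_trans h.
have r0' : 0 < r' by case/andP: hr' => h _; exact: lt_trans h.
have e1 : r * cos a = r' * cos a' by apply: torus_inj_pos K0 _ _ x0 y0; rewrite /c; lra.
have e2 : r * sin a = r' * sin a' by apply: torus_inj_pos K0 _ _ x1 y1; rewrite /c; lra.
have [er ec es] := polar_inj r0 r0' e1 e2.
(* Here the shear counts turns: [p2 + a] is known and the two values of [p2] differ by less than
   [2 * pi], so the angles do as well. *)
have ea : a = a'.
  apply: circle_inj ec es _.
  have -> : a - a' = p2' - p2 by lra.
  by move: hp2 hp2'; rewrite !ltr_norml => /andP[? ?] /andP[? ?]; apply/andP; split; lra.
subst r' a' q'.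
have dE := lift_dist r y a (p + q) y' (p' + q).
have dpE : (p + q - (p' + q)) = p - p' by ring.
rewrite dpE in dE.
(* The side [2 * pi * K] equals [pi * A + pi * A * rho]. The first summand bounds the difference of
   the [y]; the second bounds that of the [p / r], since [r > rho] and
   [2 * k = pi * A * rho * rho]. *)
have dlt : (y - y') ^+ 2 + ((p - p') / r) ^+ 2 < (2 * pi * K) ^+ 2.
  have h1 : `|y - y'| < pi * A.
    by move: hy hy'; rewrite !ltr_norml => /andP[? ?] /andP[? ?]; apply/andP; split; lra.
  have h2 : `|(p - p') / r| < pi * A * rho.
    rewrite normrM normfV (gtr0_norm r0) ltr_pdivrMr //.
    have : `|p - p'| < 2 * k.
      by move: hp hp'; rewrite !ltr_norml => /andP[? ?] /andP[? ?]; apply/andP; split; lra.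
    move/lt_trans; apply; case/andP: hr => h _.
    have -> : 2 * k = pi * A * rho * rho by rewrite /k; field.
    by rewrite ltr_pM2l // !mulr_gt0.
  have g1 : (y - y') ^+ 2 < (pi * A) ^+ 2.
    by rewrite -(real_normK (num_real _)) ltr_sqr ?nnegrE ?normr_ge0 // mulr_ge0 ?ltW.
  have g2 : ((p - p') / r) ^+ 2 < (pi * A * rho) ^+ 2.
    by rewrite -(real_normK (num_real _)) ltr_sqr ?nnegrE ?normr_ge0 // !mulr_ge0 ?ltW.
  have -> : (2 * pi * K) ^+ 2 = (pi * A) ^+ 2 + (pi * A * rho) ^+ 2 + 2 * (pi * A) ^+ 2 * rho.
    by rewrite /K; field.
  have : 0 < 2 * (pi * A) ^+ 2 * rho by rewrite !mulr_gt0 // exprn_gt0 // mulr_gt0.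
  lra.
have piK : 0 <= 2 * pi * K.
  by apply: mulr_ge0; [apply: mulr_ge0 => //|]; exact: ltW.
have small (s t : R) : s ^+ 2 + t ^+ 2 < (2 * pi * K) ^+ 2 -> `|s| < 2 * pi * K.
  move=> h; rewrite -ltr_sqr ?nnegrE ?normr_ge0 // real_normK ?num_real //.
  by apply: le_lt_trans h; rewrite lerDl sqr_ge0.
rewrite -dE in dlt.
have f1 : lift_cos r y a (p + q) = lift_cos r y' a (p' + q).
  by apply: torus_inj_angle K0 _ (small _ _ dlt) x0 y0; rewrite /c; lra.
have f2 : lift_sin r y a (p + q) = lift_sin r y' a (p' + q).
  by rewrite addrC in dlt; apply: torus_inj_angle K0 _ (small _ _ dlt) x1 y1; rewrite /c; lra.
move/esym/eqP: dE; rewrite f1 f2 !subrr expr0n addr0 paddr_eq0 ?sqr_ge0 //.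
rewrite !sqrf_eq0 mulf_eq0 invr_eq0 (gt_eqF r0) orbF !subr_eq0 => /andP[/eqP -> /eqP ->].
by split=> //; lra.
Qed.

(** Each squared radius is [A * (1 + rho)] times a Cartesian coordinate plus [1 + rho]. The joint
    bound improves the factor [4] to [7 / 2 = 2 + 3 / 2], where [3 / 2] is a rational bound for
    [cos a + sin a], at most the root of [2]. *)
Lemma wrapping_norm (r a : R) (s t : R) : rho < r < 1 + rho ->
  let K := A * (1 + rho) / 2 in let c := 1 + rho in
  let N0 := torus_x K c (r * cos a) s ^+ 2 + torus_y K c (r * cos a) s ^+ 2 in
  let N1 := torus_x K c (r * sin a) t ^+ 2 + torus_y K c (r * sin a) t ^+ 2 in
  [/\ N0 < 2 * A * (1 + rho) ^+ 2, N1 < 2 * A * (1 + rho) ^+ 2 &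
      N0 + N1 < 7 / 2 * A * (1 + rho) ^+ 2].
Proof.
move=> hr K c N0 N1; have K0 : 0 < K by rewrite /K !mulr_gt0 // ltr_wpDl.
have [/andP[b1 b2] /andP[b3 b4]] := polar_itv a hr.
rewrite /N0 /N1 !torus_sqr // /c /K; try lra.
have Ar : 0 < A * (1 + rho) by rewrite mulr_gt0 // ltr_wpDl.
have E (t1 t2 : R) : t1 < t2 * (1 + rho) ->
    A * (1 + rho) * t1 < t2 * A * (1 + rho) ^+ 2.
  move=> h; have -> : t2 * A * (1 + rho) ^+ 2 = A * (1 + rho) * (t2 * (1 + rho)) by ring.
  by rewrite ltr_pM2l.
have CS : cos a + sin a <= 3 / 2.
  have := cos2Dsin2 a; move: (cos a) (sin a) => C S h.
  have := sqr_ge0 (C - S); rewrite !expr2 in h *; nra.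
have {}CS : r * cos a + r * sin a < 3 / 2 * (1 + rho).
  case/andP: hr => h1 h2; have r0 := lt_trans rho0 h1.
  rewrite -mulrDr; apply: le_lt_trans (_ : r * (3 / 2) < _); first by rewrite ler_pM2l.
  by rewrite mulrC ltr_pM2l.
have -> t1 : 2 * (A * (1 + rho) / 2) * t1 = A * (1 + rho) * t1 by field.
have -> t1 : 2 * (A * (1 + rho) / 2) * t1 = A * (1 + rho) * t1 by field.
by split; [apply: E; lra|apply: E; lra|rewrite -mulrDr; apply: E; lra].
Qed.

End wrapping.

Lemma eq_sum3 (M : zmodType) n (F G : 'I_n -> M) (i0 i1 i2 : 'I_n) :
  i1 != i0 -> i2 != i0 -> i2 != i1 ->
  F i0 + (F i1 + F i2) = G i0 + (G i1 + G i2) ->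
  (forall i, i != i0 -> i != i1 -> i != i2 -> F i = G i) ->
  \sum_i F i = \sum_i G i.
Proof.
move=> i10 i20 i21 FG3 FG.
rewrite (bigD1 i0) //= (bigD1 i1) //= (bigD1 i2) /=; last by rewrite i20.
rewrite [in RHS](bigD1 i0) //= [in RHS](bigD1 i1) //=.
rewrite [in RHS](bigD1 i2) /=; last by rewrite i20.
rewrite !addrA -!(addrA _ _ (F i2)) FG3 !addrA; congr (_ + _).
by apply: eq_bigr => i /andP[/andP[h0 h1] h2]; exact: FG.
Qed.

(** * The wrapping step applied to the coordinates of an embedding *)

Section step.
Context {R : realType} {n : nat}.
Local Notation V := 'rV[R]_(2 * n).
Variable U : set V.
Implicit Types (X Y : 'I_n -> V -> R).

(** The data of a symplectic embedding of [U] with no target prescribed. Keeping coordinate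
    functions lets a step replace three pairs of functions on the same [U] instead of composing
    maps. *)
Definition symplectic_coords X Y : Prop :=
  [/\ forall i, smooth_on U (X i), forall i, smooth_on U (Y i),
      forall x, U x -> forall u v, \sum_i wedge (X i) (Y i) x u v = omega0 u v &
      forall x y, U x -> U y -> (forall i, X i x = X i y) ->
        (forall i, Y i x = Y i y) -> x = y].

Definition pair_norm X Y i x : R := X i x ^+ 2 + Y i x ^+ 2.

Section wrap.
Variables (X Y : 'I_n -> V -> R) (A rho : R) (i0 i1 i2 : 'I_n).
Hypotheses (oU : open U) (XY : symplectic_coords X Y).
Hypotheses (A0 : 0 < A) (rho0 : 0 < rho).
Hypotheses (i10 : i1 != i0) (i20 : i2 != i0) (i21 : i2 != i1).
Hypothesis bound : forall x, U x -> pair_norm X Y i0 x < A.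

Let k : R := pi * A * rho ^+ 2 / 2.
Let K : R := A * (1 + rho) / 2.
(** The translation moves the interval of length [1] centred at [0] to radii between [rho] and
    [1 + rho], away from the singularity of polar coordinates. *)
Let r z := rect_pos A (X i0 z) + (rho + 1 / 2).
Let y z := rect_mom A (X i0 z) (Y i0 z).
Let phi z := strip_pos k (X i1 z) (Y i1 z).
Let p z := strip_mom k (Y i1 z).
Let q z := strip_pos pi (X i2 z) (Y i2 z).
Let p2 z := strip_mom pi (Y i2 z).
(** One half of the shear; the other half is [p2 z + phi z] in [Y']. *)
Let pt z := p z + q z.
Let xi z := r z * cos (phi z).
Let eta z := lift_cos (r z) (y z) (phi z) (pt z).
Let ze z := r z * sin (phi z).
Let th z := lift_sin (r z) (y z) (phi z) (pt z).
Let X' i z := if i == i0 then torus_x K (1 + rho) (xi z) (eta z)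
  else if i == i1 then torus_x K (1 + rho) (ze z) (th z)
  else if i == i2 then q z else X i z.
Let Y' i z := if i == i0 then torus_y K (1 + rho) (xi z) (eta z)
  else if i == i1 then torus_y K (1 + rho) (ze z) (th z)
  else if i == i2 then p2 z + phi z else Y i z.

Let p0 : 0 < pi :> R. Proof. exact: pi_gt0. Qed.
Let k0 : 0 < k. Proof. by rewrite /k !mulr_gt0 // exprn_gt0. Qed.
Let K0 : 0 < K. Proof. by rewrite /K !mulr_gt0 // ltr_wpDl. Qed.

Let r_itv x : U x -> rho < r x < 1 + rho.
Proof.
move=> Ux; have /andP[h1 h2] := rect_pos_itv A0 (bound Ux).
by rewrite /r; apply/andP; split; lra.
Qed.

Let r_gt0 x : U x -> 0 < r x.
Proof. by move=> /r_itv/andP[h _]; exact: lt_trans h. Qed.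

Let xi_gt0 x : U x -> 0 < xi x + (1 + rho).
Proof.
move=> /r_itv hr; have [/andP[h _] _] := polar_itv rho0 (phi x) hr.
by rewrite /xi; lra.
Qed.

Let ze_gt0 x : U x -> 0 < ze x + (1 + rho).
Proof.
move=> /r_itv hr; have [_ /andP[h _]] := polar_itv rho0 (phi x) hr.
by rewrite /ze; lra.
Qed.

Let sX i : smooth_on U (X i). Proof. by case: XY. Qed.
Let sY i : smooth_on U (Y i). Proof. by case: XY. Qed.
Let s_r : smooth_on U r.
Proof. by apply: smooth_on_addc => //; exact: (smooth_on_rect_pos oU A0 bound (sX i0)). Qed.
Let s_y : smooth_on U y. Proof. exact: smooth_on_rect_mom. Qed.
Let s_phi : smooth_on U phi. Proof. exact: smooth_on_strip_pos. Qed.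
Let s_p : smooth_on U p. Proof. exact: smooth_on_strip_mom. Qed.
Let s_q : smooth_on U q. Proof. exact: smooth_on_strip_pos. Qed.
Let s_p2 : smooth_on U p2. Proof. exact: smooth_on_strip_mom. Qed.
Let s_pt : smooth_on U pt. Proof. exact: smooth_onD. Qed.
Let s_xi : smooth_on U xi. Proof. by apply: smooth_onM => //; exact: smooth_on_cos. Qed.
Let s_ze : smooth_on U ze. Proof. by apply: smooth_onM => //; exact: smooth_on_sin. Qed.
Let r_neq0 x : U x -> r x != 0. Proof. by move=> /r_gt0 /lt0r_neq0. Qed.
Let s_eta : smooth_on U eta. Proof. exact: smooth_on_lift_cos. Qed.
Let s_th : smooth_on U th. Proof. exact: smooth_on_lift_sin. Qed.

Let sX' i : smooth_on U (X' i).
Proof.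
rewrite /X'; case: eqP => _; first exact: smooth_on_torus_x.
case: eqP => _; first exact: smooth_on_torus_x.
by case: eqP => _.
Qed.

Let sY' i : smooth_on U (Y' i).
Proof.
rewrite /Y'; case: eqP => _; first exact: smooth_on_torus_y.
case: eqP => _; first exact: smooth_on_torus_y.
by case: eqP => _ //; exact: smooth_onD.
Qed.

Let smooth_diff (f : V -> R) x : smooth_on U f -> U x -> differentiable f x.
Proof. by move=> sf Ux; have [+ _] := sf 1%N; apply. Qed.

Let wedge3 x u v : U x ->
  wedge (X' i0) (Y' i0) x u v + (wedge (X' i1) (Y' i1) x u v +
    wedge (X' i2) (Y' i2) x u v) =
  wedge (X i0) (Y i0) x u v + (wedge (X i1) (Y i1) x u v +
    wedge (X i2) (Y i2) x u v).
Proof.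
move=> Ux; rewrite /X' /Y' !eqxx (negbTE i10) (negbTE i20) (negbTE i21).
have d f (sf : smooth_on U f) := smooth_diff sf Ux.
(* Undoes the map from the outside in: the two tori, then the lift coupling pairs [i0] and [i1],
   then the rectangle on [i0] and the sheared strips on [i1] and [i2]. *)
have chain (w0 w1 w2 v0 v1 v2 t0 t1 l0 l1 : R) : w0 = t0 -> w1 = t1 ->
    t0 + t1 = l0 + l1 -> l0 = v0 -> l1 + w2 = v1 + v2 ->
    w0 + (w1 + w2) = v0 + (v1 + v2).
  by move=> -> -> e <- e'; rewrite addrA e -addrA e'.
apply: chain (wedge_torus u v K0 (xi_gt0 Ux) (d _ s_xi) (d _ s_eta))
  (wedge_torus u v K0 (ze_gt0 Ux) (d _ s_ze) (d _ s_th))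
  (wedge_lift u v (r_neq0 Ux) (d _ s_r) (d _ s_y) (d _ s_phi) (d _ s_pt)) _ _.
  rewrite -(wedge_rect A0 bound (sX i0) (sY i0) u v Ux).
  exact: (wedge_shift (rho + 1 / 2) u v
    (d _ (smooth_on_rect_pos oU A0 bound (sX i0))) (d _ s_y)).
rewrite -(wedge_strip u v k0 (d _ (sX i1)) (d _ (sY i1))).
rewrite -(wedge_strip u v p0 (d _ (sX i2)) (d _ (sY i2))).
exact: (wedge_shear u v (d _ s_phi) (d _ s_p) (d _ s_q) (d _ s_p2)).
Qed.

Let wedge_sum x : U x -> forall u v, \sum_i wedge (X' i) (Y' i) x u v = omega0 u v.
Proof.
move=> Ux u v; have [_ _ h _] := XY; rewrite -(h x Ux u v).
apply: (eq_sum3 i10 i20 i21 (wedge3 u v Ux)) => i h0 h1 h2.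
by rewrite /X' /Y' (negbTE h0) (negbTE h1) (negbTE h2).
Qed.

Let inj' x x' : U x -> U x' -> (forall i, X' i x = X' i x') ->
  (forall i, Y' i x = Y' i x') -> x = x'.
Proof.
move=> Ux Ux' eX eY.
have hX0 := eX i0; have hY0 := eY i0; have hX1 := eX i1; have hY1 := eY i1.
have hX2 := eX i2; have hY2 := eY i2.
rewrite /X' eqxx in hX0; rewrite /Y' eqxx in hY0.
rewrite /X' eqxx (negbTE i10) in hX1; rewrite /Y' eqxx (negbTE i10) in hY1.
rewrite /X' eqxx (negbTE i20) (negbTE i21) in hX2.
rewrite /Y' eqxx (negbTE i20) (negbTE i21) in hY2.
have [er ey ea ep ep2] := wrapping_inj A0 rho0 (r_itv Ux) (r_itv Ux')
  (rect_mom_itv A0 (bound Ux)) (rect_mom_itv A0 (bound Ux'))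
  (strip_mom_lt (Y i1 x) k0) (strip_mom_lt (Y i1 x') k0)
  (strip_mom_lt (Y i2 x) p0) (strip_mom_lt (Y i2 x') p0)
  hX0 hY0 hX1 hY1 hX2 hY2.
have [a0 b0] := rect_inj A0 (bound Ux) (bound Ux') (addIr _ er) ey.
have [a1 b1] := strip_inj k0 ea ep.
have [a2 b2] := strip_inj p0 hX2 ep2.
have [_ _ _ inj] := XY; apply: inj => // i.
  have := eX i; rewrite /X'; case: eqP => [->|_] //; case: eqP => [->|_] //.
  by case: eqP => [->|_].
have := eY i; rewrite /Y'; case: eqP => [->|_] //; case: eqP => [->|_] //.
by case: eqP => [->|_].
Qed.

(** Pair [i0] is the bounded one, [i1] becomes bounded in exchange for doubling the bound [A] up to
    a small factor, and [i2] is the auxiliary pair that absorbs the shear and stays uncontrolled. *)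
Lemma wrap_step : exists X1 Y1, [/\ symplectic_coords X1 Y1,
  forall i x, i != i0 -> i != i1 -> i != i2 ->
    pair_norm X1 Y1 i x = pair_norm X Y i x &
  forall x, U x -> [/\ pair_norm X1 Y1 i0 x < 2 * A * (1 + rho) ^+ 2,
    pair_norm X1 Y1 i1 x < 2 * A * (1 + rho) ^+ 2 &
    pair_norm X1 Y1 i0 x + pair_norm X1 Y1 i1 x < 7 / 2 * A * (1 + rho) ^+ 2]].
Proof.
exists X', Y'; split; first by split.
  by move=> i x h0 h1 h2; rewrite /pair_norm /X' /Y' (negbTE h0) (negbTE h1) (negbTE h2).
move=> x Ux; rewrite /pair_norm /X' /Y' !eqxx (negbTE i10).
exact: (wrapping_norm A0 rho0 (phi x) (eta x) (th x) (r_itv Ux)).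
Qed.

End wrap.
End step.

(** * Iteration *)

Lemma itv_succ_neq (j k : nat) :
  ((0 < j <= k.+1) && (j != k.+1) = (0 < j <= k))%N.
Proof. by lia. Qed.

Lemma itv_neq0_neq (j m : nat) :
  ((j < m.+2) && (j != 0) && (j != m.+1) = (0 < j <= m))%N.
Proof. by lia. Qed.

Lemma itv_neqs (j k m : nat) : (k <= m -> 0 < j <= k ->
  [/\ j != 0, j != k.+1 & j != m.+2])%N.
Proof. by move=> km jk; split; lia. Qed.

Section iteration.
Context {R : realType}.

Lemma symplectic_coords_id n (U : set 'rV[R]_(2 * n)) :
  symplectic_coords U (fun i z => xcoord z i) (fun i z => ycoord z i).
Proof.
split=> [i|i|x _ u v|x y _ _]; [exact: smooth_on_xcoord|exact: smooth_on_ycoord| |].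
  by apply: eq_bigr => i _; rewrite /wedge !diff_xcoord !diff_ycoord.
exact: eq_coords.
Qed.

Lemma pair_norm_unit_ball n (x : 'rV[R]_(2 * n.+1)) : ball_times_space n.+1 1 1 x ->
  pair_norm (fun i z => xcoord z i) (fun i z => ycoord z i) ord0 x < 1.
Proof.
rewrite /ball_times_space /= expr1n (bigD1 ord0) //= big_pred0 ?addr0 //.
by move=> i; rewrite ltnS leqn0 andbN.
Qed.

Lemma coords_iter m k (e : R) : (k <= m)%N -> 0 < e ->
  let U := ball_times_space m.+3 1 (1 : R) in
  exists X Y, symplectic_coords U X Y /\
    forall x, U x -> pair_norm X Y ord0 x < 2 ^+ k + e /\
      \sum_(i < m.+3 | (0 < i <= k)%N) pair_norm X Y i x <= 2 * (2 ^+ k - 1) + e.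
Proof.
move=> + + U; have oU : open U := @open_ball_times_space _ _ _ _.
elim: k e => [|k IH] e km e0.
  exists (fun i z => xcoord z i), (fun i z => ycoord z i).
  split=> [|x Ux]; first exact: symplectic_coords_id.
  rewrite expr0 subrr mulr0 add0r big_pred0 ?(ltW e0); last by case=> [[|i] hi].
  by split=> //; apply: lt_trans (pair_norm_unit_ball Ux) _; rewrite ltrDl.
have e8 : 0 < e / 8 by rewrite divr_gt0.
have [X [Y [XY bXY]]] := IH (e / 8) (ltnW km) e8.
have M1 : 1 <= 2 ^+ k :> R by apply: exprn_ege1; rewrite ler1n.
set M : R := 2 ^+ k in M1 bXY.
pose A := M + e / 8.
have A0 : 0 < A by rewrite /A; lra.
pose rho := e / (12 * (M + e)).
have Me : 0 < 12 * (M + e) by lra.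
have rho0 : 0 < rho by rewrite divr_gt0.
have rhoE : rho * (12 * (M + e)) = e by rewrite divfK // gt_eqF.
pose i1 : 'I_m.+3 := inord k.+1.
have i1E : i1 = k.+1 :> nat by rewrite inordK // ltnS (leq_trans km) // ltnW.
have i10 : i1 != ord0 by rewrite -val_eqE /= i1E.
have i20 : ord_max != ord0 :> 'I_m.+3 by [].
have i21 : ord_max != i1 by rewrite -val_eqE /= i1E gtn_eqF // !ltnS ltnW.
have bA x : U x -> pair_norm X Y ord0 x < A by move=> /bXY[].
have [X1 [Y1 [XY1 same b1]]] := wrap_step oU XY A0 rho0 i10 i20 i21 bA.
have key : 2 * A * (1 + rho) ^+ 2 + e / 8 <= 2 * M + e.
  by rewrite /A expr2; nra.
exists X1, Y1; split=> // x Ux; have [c0 c1 _] := b1 x Ux.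
rewrite exprS -/M; split; first lra.
rewrite (bigD1 i1) /=; last by rewrite i1E /= leqnn.
have [_ s0] := bXY x Ux.
have -> : \sum_(i < m.+3 | (0 < i <= k.+1)%N && (i != i1)) pair_norm X1 Y1 i x =
    \sum_(i < m.+3 | (0 < i <= k)%N) pair_norm X Y i x.
  under eq_bigl do rewrite -val_eqE /= i1E itv_succ_neq.
  apply: eq_bigr => i hi; have [h0 h1 h2] := itv_neqs (ltnW km) hi.
  by apply: same; rewrite -val_eqE //= i1E.
lra.
Qed.

Lemma sum_pair_norm_lt m :
  let U := ball_times_space m.+3 1 (1 : R) in
  exists X Y, symplectic_coords U X Y /\
    forall x, U x -> \sum_(i < m.+3 | (i < m.+2)%N) pair_norm X Y i x <
      2 ^+ m.+2 + 2 ^+ m.+1 - 2.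
Proof.
move=> U; have oU : open U := @open_ball_times_space _ _ _ _.
(* [1 / 100] serves both as the error of the earlier steps and as [rho] in the last one; since
   [M >= 1], the gap of at least [1 / 2] is ample. *)
have e0 : 0 < 1 / 100 :> R by rewrite divr_gt0.
have [X [Y [XY bXY]]] := coords_iter (leqnn m) e0.
have M1 : 1 <= 2 ^+ m :> R by apply: exprn_ege1; rewrite ler1n.
rewrite !exprS; set M : R := 2 ^+ m in M1 bXY *.
have A0 : 0 < M + 1 / 100 by lra.
pose i1 : 'I_m.+3 := inord m.+1.
have i1E : i1 = m.+1 :> nat by rewrite inordK.
have i10 : i1 != ord0 by rewrite -val_eqE /= i1E.
have i20 : ord_max != ord0 :> 'I_m.+3 by [].
have i21 : ord_max != i1 by rewrite -val_eqE /= i1E gtn_eqF.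
have bA x : U x -> pair_norm X Y ord0 x < M + 1 / 100 by move=> /bXY[].
have [X1 [Y1 [XY1 same b1]]] := wrap_step oU XY A0 e0 i10 i20 i21 bA.
exists X1, Y1; split=> // x Ux; have [_ _ c01] := b1 x Ux.
have [_ s0] := bXY x Ux.
rewrite (bigD1 ord0) //= (bigD1 i1) /=; last by rewrite i1E leqnn.
have -> : \sum_(i < m.+3 | ((i < m.+2)%N && (i != ord0)) && (i != i1)) pair_norm X1 Y1 i x =
    \sum_(i < m.+3 | (0 < i <= m)%N) pair_norm X Y i x.
  under eq_bigl do rewrite -!val_eqE /= i1E itv_neq0_neq.
  apply: eq_bigr => i hi; have [h0 h1 h2] := itv_neqs (leqnn m) hi.
  by apply: same; rewrite -val_eqE //= i1E.
rewrite addrA; rewrite expr2 in c01; lra.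
Qed.

End iteration.

Theorem theorem1p1 (R : realType) (n : nat) (hn : (2 <= n)%N) (r : R)
    (hr : Num.sqrt (2 ^+ (n - 1) + 2 ^+ (n - 2) - 2) <= r) :
  exists f : 'rV[R]_(2 * n) -> 'rV[R]_(2 * n),
    symplectic_embedding (ball_times_space n 1 1)
                         (ball_times_space n (n - 1) r) f.
Proof.
suff : exists X Y : 'I_n -> 'rV[R]_(2 * n) -> R,
    symplectic_coords (ball_times_space n 1 1) X Y /\ forall x,
      ball_times_space n 1 1 x ->
      \sum_(i < n | (i < n - 1)%N) pair_norm X Y i x < 2 ^+ (n - 1) + 2 ^+ (n - 2) - 2.
  move=> [X [Y [[sX sY dXY inj] bXY]]].
  exists (fun z => of_coords (X^~ z) (Y^~ z)).
  apply: symplectic_embedding_of_coords => //; first exact: open_ball_times_space.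
  move=> x Ux; rewrite /ball_times_space /=.
  under eq_bigr do rewrite xcoord_of_coords ycoord_of_coords.
  have S0 : 0 <= \sum_(i < n | (i < n - 1)%N) pair_norm X Y i x.
    by apply: sumr_ge0 => i _; rewrite addr_ge0 ?sqr_ge0.
  apply: lt_le_trans (bXY x Ux) _.
  (* The radicand dominates a sum of squares, so it is nonnegative and really is the square of
     [Num.sqrt], which has value [0] on negative numbers. *)
  have a0 := le_trans S0 (ltW (bXY x Ux)).
  rewrite -[leLHS](sqr_sqrtr a0) ler_sqr ?nnegrE ?sqrtr_ge0 //.
  exact: le_trans (sqrtr_ge0 _) hr.
case: n hn {hr} => [//|[//|[|m]]] _; last first.
  by rewrite !subSS !subn0; exact: sum_pair_norm_lt.
(* For [n = 2] the radicand is [2 + 1 - 2 = 1] and the identity already works. *)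
exists (fun i z => xcoord z i), (fun i z => ycoord z i).
split=> [|x Ux]; first exact: symplectic_coords_id.
rewrite (bigD1 ord0) //= big_pred0; last by case=> [[|[|i]] hi].
by rewrite addr0 expr0 expr1; have := pair_norm_unit_ball Ux; lra.
Qed.
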